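(* There exists a universal constant $C>0$ such that the following holds. For every bounded linear operator $S : BMO(\delta^2)\to BMO(\delta^2)$, the identity on $BMO(\delta^2)$ factors through $H=S$ or through $H=\mathrm{Id}-S$; that is, for at least one choice $H\in\{S,\mathrm{Id}-S\}$ there exist bounded linear operators $E,P : BMO(\delta^2)\to BMO(\delta^2)$ such that $$P H E=\mathrm{Id}_{BMO(\delta^2)}\qquad\text{and}\qquad \|E\|\,\|P\|\le C.$$
   Context: Dyadic intervals: $\mathscr D=\{[2^{-j}k,2^{-j}(k+1)) : j,k\in\mathbb N_0,\ k\le 2^j-1\}$. Dyadic rectangles: $\mathscr R=\mathscr D\times\mathscr D$, with $I\times J\in\mathscr R$ viewed as a subset of $[0,1)^2$. For $I\in\mathscr D$ the $L^\infty$-normalized Haar function $h_I$ is $+1$ on the left half of $I$, $-1$ on the right half of $I$, and $0$ elsewhere; $h_{I\times J}(s,t)=h_I(s)h_J(t)$. Scalars are real. The space $H^1(\delta^2)$ is the completion of $\mathrm{span}\{h_{I\times J}: I\times J\in\mathscr R\}$ under the norm $$\Big\|\sum a_{I\times J}h_{I\times J}\Big\|_{H^1(\delta^2)}=\int_0^1\!\int_0^1\Big(\sum a_{I\times J}^2h_{I\times J}^2(s,t)\Big)^{1/2}ds\,dt .$$ Its dual is denoted $BMO(\delta^2)$; it consists of the bi-parameter functions (Haar series) $f=\sum a_{I\times J}h_{I\times J}$ with $\|f\|_{BMO(\delta^2)}<\infty$, where $$\|f\|_{BMO(\delta^2)}=\Big(\sup_{\Omega\text{ open}}\frac1{|\Omega|}\sum_{I\times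 J\subset\Omega}a_{I\times J}^2\,|I\times J|\Big)^{1/2},$$ the supremum being over nonempty open subsets $\Omega$ of the unit square and the sum over $I\times J\in\mathscr R$ contained in $\Omega$. *)

(* Defs.v *)
From HB Require Import structures.
From mathcomp Require Import all_boot all_order all_algebra.
From mathcomp Require Import all_classical all_reals all_analysis.
From mathcomp Require Import ring.

Set Implicit Arguments.
Unset Strict Implicit.
Unset Printing Implicit Defensive.
Import Order.TTheory GRing.Theory Num.Theory.
Import numFieldNormedType.Exports.

Local Open Scope classical_set_scope.
Local Open Scope ring_scope.

(* The index [Tagged _ k] with [k : 'I_(2 ^ j)] stands for the interval
   [k / 2^j, (k + 1) / 2^j); distinct indices give distinct intervals. *)
Definition dyadic := {j : nat & 'I_(2 ^ j)}.

Definition dyadic_rect := (dyadic * dyadic)%type.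

Section dyadic_sets.
Variable R : realType.

Definition dyadic_itv (I : dyadic) : set R :=
  `[ (tagged I)%:R / 2 ^+ tag I, (tagged I).+1%:R / 2 ^+ tag I [.

Definition rect_set (Q : dyadic_rect) : set (R * R) :=
  dyadic_itv Q.1 `*` dyadic_itv Q.2.

Definition unit_square : set (R * R) := `[0, 1[ `*` `[0, 1[.

Definition area : set (R * R) -> \bar R :=
  (@lebesgue_measure R \x @lebesgue_measure R)%E.

(* Openness is relative to [0, 1)^2: otherwise the dyadic rectangles that
   contain their left or lower edge on the axes would be in no admissible
   set, and the BMO functional below would not be a norm. *)
Definition open_in_square : set (set (R * R)) :=
  [set Om | Om !=set0 /\
    exists U : set (R * R), open U /\ Om = U `&` unit_square].

End dyadic_sets.

Arguments dyadic_itv R I : clear implicits.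
Arguments rect_set R Q : clear implicits.
Arguments unit_square R : clear implicits.
Arguments open_in_square R : clear implicits.

(* A Haar series \sum_Q a_Q h_Q is represented by its coefficient family a;
   the Haar functions are orthogonal and nonzero, so the series determines a,
   and the norm depends on a only. *)
Definition carleson_mass (R : realType) (a : dyadic_rect -> R)
    (Om : set (R * R)) : \bar R :=
  (\esum_(Q in [set Q | rect_set R Q `<=` Om])
    ((a Q ^+ 2)%:E * area (rect_set R Q)))%E.

(* Locked to keep unification from unfolding it; [unlock] exposes the body. *)
HB.lock Definition bmo_norm (R : realType) (a : dyadic_rect -> R) : \bar R :=
  (sqrte (ereal_sup
    [set carleson_mass a Om / area Om | Om in open_in_square R]))%E.
Canonical locked_bmo_norm := Unlockable bmo_norm.unlock.

Arguments bmo_norm {R} a.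

Section bmo_norm_theory.
Variable R : realType.
Implicit Types a b : dyadic_rect -> R.
Local Open Scope ereal_scope.

Lemma area_prod (A B : set R) :
  measurable (A : set (measurableTypeR R)) ->
  measurable (B : set (measurableTypeR R)) ->
  area (A `*` B) = lebesgue_measure A * lebesgue_measure B.
Proof. exact: product_measure1E. Qed.

Lemma area_ge0 (A : set (R * R)) : 0 <= area A.
Proof. exact: measure_ge0. Qed.

Lemma area_square : area (unit_square R) = 1.
Proof.
rewrite /unit_square area_prod//.
by rewrite lebesgue_measure_itv/= lte_fin ltr01 oppr0 adde0 mule1.
Qed.

Lemma lebesgue_dyadic (I : dyadic) :
  lebesgue_measure (dyadic_itv R I) = ((2 ^+ tag I)^-1)%:E.
Proof.
rewrite /dyadic_itv lebesgue_measure_itv/= lte_fin.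
have p2 : (0 < 2 ^+ tag I :> R)%R by rewrite exprn_gt0.
rewrite ltr_pM2r ?invr_gt0// ltr_nat ltnSn.
by rewrite -EFinD -mulrBl -natrB ?leqnSn// subSnn mul1r.
Qed.

Lemma area_rect (Q : dyadic_rect) :
  area (rect_set R Q) = ((2 ^+ tag Q.1)^-1 * (2 ^+ tag Q.2)^-1)%:E.
Proof.
by rewrite area_prod ?lebesgue_dyadic//; exact: measurable_itv.
Qed.

Lemma dyadic_itv_sub (I : dyadic) : dyadic_itv R I `<=` `[0%R, 1%R[.
Proof.
case: I => j k x; rewrite /dyadic_itv /= !in_itv /= => /andP[kx xk].
apply/andP; split; first exact: le_trans kx.
apply: lt_le_trans xk _.
by rewrite ler_pdivrMr ?exprn_gt0// mul1r -natrX ler_nat ltn_ord.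
Qed.

Lemma rect_sub_square (Q : dyadic_rect) : rect_set R Q `<=` unit_square R.
Proof. by move=> -[s t] [/dyadic_itv_sub ? /dyadic_itv_sub ?]. Qed.

Lemma open_in_square_square : open_in_square R (unit_square R).
Proof.
split; first by exists (0, 0)%R; split=> /=; rewrite in_itv/= lexx ltr01.
by exists setT; split; [exact: openT | rewrite setTI].
Qed.

Let msq a := ereal_sup
  [set carleson_mass a Om / area Om | Om in open_in_square R].

Let carleson_mass_ge0 a Om : 0 <= carleson_mass a Om.
Proof.
apply: esum_ge0 => Q _.
by rewrite mule_ge0 ?area_ge0// lee_fin sqr_ge0.
Qed.

Let bmo_normE a : bmo_norm a = sqrte (msq a).
Proof. by rewrite unlock. Qed.

Let msq_ge0 a : 0 <= msq a.
Proof.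
apply: le_trans (ereal_sup_ubound _); last first.
  by exists (unit_square R) => //; exact: open_in_square_square.
by rewrite mule_ge0 ?carleson_mass_ge0// inve_ge0 area_ge0.
Qed.

Let carleson_massD a b (t : R) Om : (0 < t)%R ->
  carleson_mass (a \+ b)%R Om <=
  (1 + t)%:E * carleson_mass a Om + (1 + t^-1)%:E * carleson_mass b Om.
Proof.
move=> t0; apply: ge_ereal_sup => _ /= [F [finF FOm] <-].
have ge0 c Q : 0 <= (c Q ^+ 2)%:E * area (rect_set R Q) :> \bar R.
  by rewrite mule_ge0 ?area_ge0// lee_fin sqr_ge0.
have t1 : (0 <= 1 + t)%R by rewrite addr_ge0// ltW.
have t2 : (0 <= 1 + t^-1)%R by rewrite addr_ge0// invr_ge0 ltW.
apply: (@le_trans _ _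
  ((1 + t)%:E * (\sum_(Q \in F) (a Q ^+ 2)%:E * area (rect_set R Q)) +
   (1 + t^-1)%:E * (\sum_(Q \in F) (b Q ^+ 2)%:E * area (rect_set R Q)))).
  rewrite !ge0_mule_fsumr// -fsbig_split//=.
  apply: lee_fsum => // Q _.
  rewrite !muleA -ge0_muleDl ?mule_ge0 ?lee_fin ?sqr_ge0//.
  rewrite lee_wpmul2r ?area_ge0// -!EFinM -EFinD lee_fin.
  rewrite -subr_ge0 [leRHS](_ : _ = t^-1 * (t * a Q - b Q) ^+ 2)%R.
    by rewrite mulr_ge0 ?sqr_ge0// invr_ge0 ltW.
  have tt : (t^-1 * t = 1)%R by rewrite mulVf// gt_eqF.
  by rewrite /=; field; rewrite gt_eqF.
rewrite leeD// lee_wpmul2l ?lee_fin//; apply: ereal_sup_ubound;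
  by exists F.
Qed.

Let msqD a b (t : R) : (0 < t)%R ->
  msq (a \+ b)%R <= (1 + t)%:E * msq a + (1 + t^-1)%:E * msq b.
Proof.
move=> t0; apply: ge_ereal_sup => _ /= [Om oOm <-].
have t1 : (0 <= 1 + t)%R by rewrite addr_ge0// ltW.
have t2 : (0 <= 1 + t^-1)%R by rewrite addr_ge0// invr_ge0 ltW.
have A0 : 0 <= (area Om)^-1 by rewrite inve_ge0 area_ge0.
apply: le_trans (lee_wpmul2r A0 (carleson_massD a b Om t0)) _.
rewrite ge0_muleDl ?mule_ge0 ?carleson_mass_ge0 ?lee_fin// -!muleA.
by rewrite leeD// lee_wpmul2l ?lee_fin//; apply: ereal_sup_ubound;
  exists Om.
Qed.

Let msqZ_le a (c : R) : msq (c \*o a)%R <= (c ^+ 2)%:E * msq a.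
Proof.
apply: ge_ereal_sup => _ /= [Om oOm <-].
have A0 : 0 <= (area Om)^-1 by rewrite inve_ge0 area_ge0.
apply: (@le_trans _ _ ((c ^+ 2)%:E * carleson_mass a Om / area Om)).
  rewrite lee_wpmul2r//; apply: ge_ereal_sup => _ /= [F [finF FOm] <-].
  rewrite (eq_fsbigr (fun Q =>
    (c ^+ 2)%:E * ((a Q ^+ 2)%:E * area (rect_set R Q)))); last first.
    by move=> Q _; rewrite muleA -EFinM exprMn.
  rewrite -ge0_mule_fsumr; last first.
    by move=> Q; rewrite mule_ge0 ?area_ge0// lee_fin sqr_ge0.
  rewrite lee_wpmul2l ?lee_fin ?sqr_ge0//.
  by apply: ereal_sup_ubound; exists F.
rewrite -muleA lee_wpmul2l ?lee_fin ?sqr_ge0//.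
by apply: ereal_sup_ubound; exists Om.
Qed.

Let coef_le_msq a Q : (a Q ^+ 2)%:E * area (rect_set R Q) <= msq a.
Proof.
apply: (@le_trans _ _ (carleson_mass a (unit_square R) / area (unit_square R))).
  rewrite area_square inve1 mule1.
  apply: ereal_sup_ubound; exists [set Q]; last by rewrite fsbig_set1.
  by split => // _ ->; exact: rect_sub_square.
by apply: ereal_sup_ubound; exists (unit_square R) => //;
  exact: open_in_square_square.
Qed.

Lemma bmo_norm_ge0 a : 0 <= bmo_norm a.
Proof. by rewrite bmo_normE sqrte_ge0. Qed.

Lemma bmo_norm_eq0 a : bmo_norm a = 0 -> forall Q, a Q = 0%R.
Proof.
move=> a0 Q; have ma0 : msq a = 0.
  by rewrite -[LHS]sqr_sqrte ?msq_ge0// -bmo_normE a0 expe2 mul0e.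
have := coef_le_msq a Q; rewrite ma0 area_rect -EFinM lee_fin.
rewrite pmulr_lle0 ?mulr_gt0 ?invr_gt0 ?exprn_gt0// => aQ.
by apply/eqP; rewrite -sqrf_eq0 eq_le aQ sqr_ge0.
Qed.

Lemma bmo_norm0 : bmo_norm (fun=> 0%R : R) = 0.
Proof.
suff m0 : msq (fun=> 0%R) = 0 by rewrite bmo_normE m0 sqrte0.
apply/eqP; rewrite eq_le msq_ge0 andbT.
have := msqZ_le (fun=> 0%R) 0; rewrite expr0n mul0e.
by have -> : (0 \*o (fun=> 0))%R = (fun=> 0%R) :> (dyadic_rect -> R)
  by apply/funext => ? /=; rewrite mul0r.
Qed.

Lemma bmo_norm_lty a : (bmo_norm a < +oo) = (msq a < +oo).
Proof.
by rewrite -!ge0_fin_numE ?bmo_norm_ge0 ?msq_ge0// bmo_normE sqrte_fin_num ?msq_ge0.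
Qed.

Lemma bmo_normZ_le a (c : R) : bmo_norm (c \*o a)%R <= `|c|%:E * bmo_norm a.
Proof.
have -> : `|c|%:E = sqrte (c ^+ 2)%:E by rewrite /= sqrtr_sqr.
rewrite 2!bmo_normE.
by rewrite -sqrteM ?lee_fin ?sqr_ge0// lee_sqrt ?msqZ_le// mule_ge0 ?msq_ge0//
  lee_fin sqr_ge0.
Qed.

Lemma bmo_normZ a (c : R) : bmo_norm (c \*o a)%R = `|c|%:E * bmo_norm a.
Proof.
apply/eqP; rewrite eq_le bmo_normZ_le/=.
have [->|c0] := eqVneq c 0%R; first by rewrite normr0 mul0e bmo_norm_ge0.
have ca : a = (c^-1 \*o (c \*o a))%R.
  by apply/funext => Q /=; rewrite mulrA mulVf// mul1r.
rewrite {1}ca; apply: le_trans (lee_wpmul2l _ (bmo_normZ_le _ _)) _.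
  by rewrite lee_fin.
by rewrite muleA -EFinM -normrM mulfV// normr1 mul1e.
Qed.

Lemma bmo_norm_triangle a b :
  bmo_norm a < +oo -> bmo_norm b < +oo ->
  bmo_norm (a \+ b)%R <= bmo_norm a + bmo_norm b.
Proof.
have [a0 _ _|a0] := eqVneq (bmo_norm a) 0.
  suff -> : (a \+ b)%R = b by rewrite a0 add0e.
  by apply/funext => Q /=; rewrite (bmo_norm_eq0 a0) add0r.
have [b0 _ _|b0] := eqVneq (bmo_norm b) 0.
  suff -> : (a \+ b)%R = a by rewrite b0 adde0.
  by apply/funext => Q /=; rewrite (bmo_norm_eq0 b0) addr0.
move=> aoo boo.
have sE c : msq c = bmo_norm c ^+ 2 by rewrite bmo_normE sqr_sqrte ?msq_ge0.
have := bmo_norm_ge0 a; have := bmo_norm_ge0 b.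
case: (bmo_norm a) (sE a) a0 aoo => [A||]// mA A0 _.
case: (bmo_norm b) (sE b) b0 boo => [B||]// mB B0 _.
rewrite !lee_fin => B_ge0 A_ge0.
have {}A0 : (0 < A)%R by rewrite lt_neqAle A_ge0 andbT eq_sym -eqe.
have {}B0 : (0 < B)%R by rewrite lt_neqAle B_ge0 andbT eq_sym -eqe.
have := @msqD a b (B / A) (divr_gt0 B0 A0).
rewrite mA mB !expe2 -!EFinM -EFinD.
have -> : ((1 + B / A) * (A * A) + (1 + (B / A)^-1) * (B * B) =
    (A + B) ^+ 2)%R by field; rewrite !gt_eqF.
move=> le_ab; rewrite -EFinD.
have -> : (A + B)%:E = sqrte ((A + B) ^+ 2)%:E :> \bar R.
  by rewrite /= sqrtr_sqr ger0_norm// addr_ge0.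
by rewrite bmo_normE lee_sqrt// lee_fin sqr_ge0.
Qed.

End bmo_norm_theory.

Section bmo_space.
Variable R : realType.

Definition finite_bmo : {pred (dyadic_rect -> R)} :=
  mem [set a | (bmo_norm a < +oo)%E].

Record BMO := MkBMO {
  bmo_coef :> dyadic_rect -> R ;
  _ : bmo_coef \in finite_bmo }.

HB.instance Definition _ := [isSub for bmo_coef].
HB.instance Definition _ := [Choice of BMO by <:].

Lemma finite_bmoE (a : dyadic_rect -> R) :
  (a \in finite_bmo) = (bmo_norm a < +oo)%E.
Proof. by apply/idP/idP => [/set_mem|/mem_set]. Qed.

Lemma bmo_lty (f : BMO) : (bmo_norm f < +oo)%E.
Proof. by rewrite -finite_bmoE; case: f. Qed.

Lemma finite_bmo_submod_closed : submod_closed finite_bmo.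
Proof.
split; first by rewrite finite_bmoE bmo_norm0 ltry.
move=> c a b; rewrite 3!finite_bmoE => aoo boo.
have caoo : (bmo_norm (c \*o a)%R < +oo)%E.
  rewrite bmo_normZ; apply: lte_mul_pinfty aoo; last exact: erefl.
  by rewrite lee_fin.
exact: le_lt_trans (bmo_norm_triangle caoo boo) (lte_add_pinfty caoo boo).
Qed.

HB.instance Definition _ := GRing.isSubmodClosed.Build _ _ finite_bmo
  finite_bmo_submod_closed.
HB.instance Definition _ := [SubChoice_isSubLmodule of BMO by <:].

Definition bmo_fine_norm (f : BMO) : R := fine (bmo_norm f).

Lemma bmo_fine_normE (f : BMO) : (bmo_fine_norm f)%:E = bmo_norm f.
Proof.
by rewrite fineK// (ge0_fin_numE (bmo_norm_ge0 _)) bmo_lty.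
Qed.

Lemma bmo_fine_normD (f g : BMO) :
  bmo_fine_norm (f + g) <= bmo_fine_norm f + bmo_fine_norm g.
Proof.
rewrite -lee_fin EFinD (bmo_fine_normE (f + g)) (bmo_fine_normE f).
rewrite (bmo_fine_normE g).
exact: bmo_norm_triangle (bmo_lty f) (bmo_lty g).
Qed.

Lemma bmo_fine_normZ (c : R) (f : BMO) :
  bmo_fine_norm (c *: f) = `|c| * bmo_fine_norm f.
Proof.
apply: EFin_inj; rewrite EFinM (bmo_fine_normE (c *: f)) (bmo_fine_normE f).
exact: bmo_normZ.
Qed.

Lemma bmo_fine_norm_eq0 (f : BMO) : bmo_fine_norm f = 0 -> f = 0.
Proof.
move=> fn0; have f0 : bmo_norm f = 0%E by rewrite -bmo_fine_normE fn0.
by apply: val_inj; apply/funext => Q; exact: bmo_norm_eq0 f0 Q.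
Qed.

HB.instance Definition _ := Lmodule_isNormed.Build R BMO
  bmo_fine_normD bmo_fine_normZ bmo_fine_norm_eq0.

End bmo_space.

(* Extended-real valued, so that it is +oo, not a default value, when f is
   unbounded. *)
Definition opnorm (R : realType) (V W : normedModType R) (f : V -> W) : \bar R :=
  ereal_sup [set `|f x|%:E | x in [set x : V | `|x| <= 1]].

(* Main.v *)
From HB Require Import structures.
Require Import Defs.
From mathcomp Require Import all_boot all_order all_algebra.
From mathcomp Require Import all_classical all_reals all_analysis.
From mathcomp Require Import ring lra zify.

Set Implicit Arguments.
Unset Strict Implicit.
Unset Printing Implicit Defensive.
Import Order.TTheory GRing.Theory Num.Theory.
Import numFieldNormedType.Exports.
Local Open Scope classical_set_scope.
Local Open Scope ring_scope.

(** The theorem follows from a scalar compression of the operator: for every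
    bounded S there are contractions E and P of BMO and a number lam with
    P E = Id and P S E = lam Id [scalar_compression].  One of |lam| and
    |1 - lam| is at least 1/2; dividing P by lam, or by 1 - lam, factors the
    identity through S, or through Id - S, with constant 2.

    Coordinates.  A dyadic interval is a binary word and a point is a long word
    extending it.  The square of the BMO norm is the best constant in a Carleson
    inequality for finite families of pairs of words, in which areas are averages
    over words of a fixed length [carleson_of_bmo, bmo_of_carleson].  The norm
    sees the coefficients only through their absolute values, so that the signs
    of a block basis are free.

    Blocks.  Fix positions m_0 < m_1 < ... of digits.  An interval I, that is, a
    word of length i, is carried by all words of length m_i whose digits at the
    positions m_0, ..., m_(i-1) spell I.  In two variables take products of
    carriers: the embedding replaces h_(I x J) by the signed sum of the h_(K x L)
    over the carriers of I x J, and the projection averages the signed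
    coefficients over them.  Overwriting the digits at the chosen positions by
    random ones preserves the uniform measure [wmean_insert].  With all other
    digits frozen each I has exactly one carrier, and containments among the I
    lift to containments among their carriers; therefore the Carleson inequality
    passes from a series to its embedding, and, with the Cauchy-Schwarz
    inequality, from a series to its projection [carleson_embed,
    carleson_project].

    One strip.  Strip n consists of the rectangles whose first side lies in the
    interval of the word 1^n 0.  In it, the compression of S to blocks of depth n
    can be made almost scalar [block_system_exists].  A random choice of the
    signs makes all entries off the diagonal small, because S maps a signed sum
    of disjoint Haar functions to a function of norm at most ||S||, while each
    single carrier has small weight.  The diagonal entry at I x J is the average
    over the carriers of I x J of the numbers (S h_(K x L))_(K x L).  A double
    limit yields levels at which the average of these numbers over all words of
    the given lengths is almost constant; letting the digits that spell I depend
    on a twist of the first p digits makes the average over the carriers of each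
    I x J almost equal to it [twist_exists].

    Many strips.  S is not assumed to be weak-star continuous, hence it is not
    determined by its values on Haar functions.  Let E put a copy of f in each
    of infinitely many strips, and let P be the limit along an ultrafilter of the
    projections taken from those strips.  Only errors that do not tend to 0 with
    the strip would matter.  What S moves into strip n from earlier strips comes
    from finitely many vectors and is killed by the choice of signs in strip n;
    what comes from later strips is killed by passing to a sparse set of strips,
    since a bounded functional on an l^infinity-sum cannot be large on many
    disjoint partial sums [rosenthal, selection_exists]. *)

(** * Means over binary words *)

Notation word := (seq bool).

Section word_mean.
Variable R : realFieldType.
Implicit Types (G H : word -> R) (N : nat) (x u : word) (c k : R).

(** The average of G over the 2^N words of length N.  The recursion on the first
    digit gives linearity, monotony and the exchange of averages by induction. *)
Fixpoint wmean N G : R :=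
  if N is N'.+1 then
    (wmean N' (fun x => G (false :: x)) + wmean N' (fun x => G (true :: x))) / 2
  else G [::].

Lemma eq_wmean N G H : (forall x, size x = N -> G x = H x) ->
  wmean N G = wmean N H.
Proof.
elim: N G H => [|N IH] G H GH /=; first exact: GH.
by congr ((_ + _) / 2); apply: IH => x Nx; apply: GH; rewrite /= Nx.
Qed.

Lemma ler_wmean N G H : (forall x, size x = N -> G x <= H x) ->
  wmean N G <= wmean N H.
Proof.
elim: N G H => [|N IH] G H GH /=; first exact: GH.
rewrite ler_pM2r ?invr_gt0// lerD//; apply: IH => x Nx; apply: GH;
  by rewrite /= Nx.
Qed.

Lemma wmeanD N G H : wmean N (fun x => G x + H x) = wmean N G + wmean N H.
Proof. by elim: N G H => [|N IH] G H //=; rewrite !IH; ring. Qed.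

Lemma wmeanZ N c G : wmean N (fun x => c * G x) = c * wmean N G.
Proof. by elim: N G => [|N IH] G //=; rewrite !IH; ring. Qed.

Lemma wmean_cst N c : wmean N (fun=> c) = c.
Proof. by elim: N => [|N IH] //=; rewrite !IH; field. Qed.

Lemma wmean_ge0 N G : (forall x, size x = N -> 0 <= G x) -> 0 <= wmean N G.
Proof. by move=> G0; rewrite -(wmean_cst N 0); exact: ler_wmean. Qed.

Lemma wmeanB N G H : wmean N (fun x => G x - H x) = wmean N G - wmean N H.
Proof. by elim: N G H => [|N IH] G H //=; rewrite !IH; ring. Qed.

Lemma wmean_sum N (I : Type) (r : seq I) (P : pred I) (G : I -> word -> R) :
  wmean N (fun x => \sum_(i <- r | P i) G i x) = \sum_(i <- r | P i) wmean N (G i).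
Proof.
elim: r => [|i r IH].
  by under eq_wmean do rewrite big_nil; rewrite big_nil wmean_cst.
rewrite big_cons -IH; case: ifP => Pi.
  by rewrite -wmeanD; apply: eq_wmean => x _; rewrite big_cons Pi.
by apply: eq_wmean => x _; rewrite big_cons Pi.
Qed.

Lemma exchange_wmean N N' (G : word -> word -> R) :
  wmean N (fun x => wmean N' (G x)) = wmean N' (fun y => wmean N (G^~ y)).
Proof.
elim: N G => [|N IH] G //=; rewrite !IH -wmeanD.
by rewrite mulrC -wmeanZ; apply: eq_wmean => y _; rewrite mulrC.
Qed.

Lemma ler_norm_wmean N G : `|wmean N G| <= wmean N (fun x => `|G x|).
Proof.
elim: N G => [|N IH] G //=.
rewrite normrM (@ger0_norm _ 2^-1) ?invr_ge0// ler_pM2r ?invr_gt0//.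
by apply: le_trans (ler_normD _ _) _; rewrite lerD.
Qed.

Lemma wmean_sqr N G : wmean N G ^+ 2 <= wmean N (fun x => G x ^+ 2).
Proof.
elim: N G => [|N IH] G //=.
have A := IH (fun x => G (false :: x)); have B := IH (fun x => G (true :: x)).
set a := wmean N _ in A *; set b := wmean N _ in B *.
have := sqr_ge0 (a - b); set a2 := wmean N _ in A *; set b2 := wmean N _ in B *.
lra.
Qed.

Lemma wmean_cat N M G :
  wmean (N + M) G = wmean N (fun x => wmean M (fun y => G (x ++ y))).
Proof. by elim: N G => [|N IH] G //=; rewrite !IH. Qed.

Lemma wmean_take N M G : (N <= M)%N -> wmean M (fun x => G (take N x)) = wmean N G.
Proof.
move=> /subnKC <-; rewrite wmean_cat; apply: eq_wmean => x Nx.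
by under eq_wmean do rewrite take_size_cat//; exact: wmean_cst.
Qed.

Lemma wmeanE N G : wmean N G = (2 ^+ N)^-1 * \sum_(x : N.-tuple bool) G x.
Proof.
elim: N G => [|N IH] G.
  rewrite expr0 invr1 mul1r (big_pred1 [tuple])// => x.
  by symmetry; apply/eqP; rewrite [x]tuple0.
rewrite /= !IH exprS invfM.
suff -> : \sum_(x : N.+1.-tuple bool) G x =
    \sum_(x : N.-tuple bool) G (false :: x) + \sum_(x : N.-tuple bool) G (true :: x).
  by ring.
rewrite (reindex (fun p : bool * N.-tuple bool => cons_tuple p.1 p.2))/=.
  rewrite -(pair_bigA _ (fun b (x : N.-tuple bool) => G (b :: x)))/=.
  by rewrite big_bool addrC.
exists (fun z => (thead z, behead_tuple z)) => [[b z] _|z _] /=.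
  by congr pair; apply: val_inj.
by rewrite [RHS]tuple_eta; apply: val_inj.
Qed.

(** Exchanging the label of x with an independent uniform word u is an
    involution of the pairs (x, u), hence it preserves their uniform measure. *)
Lemma wmean_swap N n (insert : word -> word -> word) (label : word -> word)
    (G : word -> word -> R) :
  (forall x u, size x = N -> size u = n ->
    [/\ size (insert x u) = N, label (insert x u) = u & insert (insert x u) (label x) = x]) ->
  (forall x, size x = N -> size (label x) = n) ->
  wmean N (fun x => wmean n (fun u => G (insert x u) u)) =
  wmean N (fun x => G x (label x)).
Proof.
move=> insertP labelP.
transitivity (wmean N (fun x => wmean n (fun u => G x (label x)))); last first.
  by under eq_wmean do rewrite wmean_cst.
rewrite !wmeanE; congr (_ * _).
under eq_bigr do rewrite wmeanE; under [RHS]eq_bigr do rewrite wmeanE.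
rewrite -!mulr_sumr; congr (_ * _).
rewrite !pair_big/=.
have szP (x : N.-tuple bool) (u : n.-tuple bool) : size (insert x u) == N.
  by have [/eqP] := insertP x u (size_tuple x) (size_tuple u).
have slP (x : N.-tuple bool) : size (label x) == n.
  by rewrite labelP ?size_tuple.
pose s (p : N.-tuple bool * n.-tuple bool) := (Tuple (szP p.1 p.2), Tuple (slP p.1)).
have ss : involutive s.
  move=> [x u]; have [_ e1 e2] := insertP x u (size_tuple x) (size_tuple u).
  by congr pair; apply: val_inj.
rewrite [RHS](reindex_inj (inv_inj ss))/=; apply: eq_bigr => -[x u] _ /=.
by have [_ -> _] := insertP x u (size_tuple x) (size_tuple u).
Qed.

End word_mean.

(** * The Carleson condition on words *)

Section carleson.
Variable R : realFieldType.
Implicit Types (a b : word -> word -> R) (F : word -> word -> bool).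
Implicit Types (N : nat) (x y u v K L : word) (k : R).

(** Pairs of words of lengths N and N' are the cells of a grid; a cell is hit by
    a family F of rectangles when it lies in their union. *)
Definition hits F N N' x y :=
  [exists i : 'I_N.+1, [exists j : 'I_N'.+1, F (take i x) (take j y)]].

Definition sqsum F a N N' x y : R :=
  \sum_(i < N.+1) \sum_(j < N'.+1) (F (take i x) (take j y))%:R *
    a (take i x) (take j y) ^+ 2.

(** The packing inequality sum_(Q in F) a_Q^2 |Q| <= k |union of F|, for the
    rectangles of F with sides of lengths at least 2^-N and 2^-N'.  Both sides are
    written as averages over the cells of the grid. *)
Definition carleson k N N' a := forall F,
  wmean N (fun x => wmean N' (fun y => sqsum F a N N' x y)) <=
  k * wmean N (fun x => wmean N' (fun y => (hits F N N' x y)%:R)).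

Lemma hitsP F N N' x y :
  reflect (exists i j, [/\ (i <= N)%N, (j <= N')%N & F (take i x) (take j y)])
    (hits F N N' x y).
Proof.
apply: (iffP existsP) => [[i /existsP[j Fij]]|[i [j [iN jN Fij]]]].
  by exists i, j; rewrite -ltnS ltn_ord -ltnS ltn_ord.
exists (Ordinal (iN : (i < N.+1)%N)); apply/existsP.
by exists (Ordinal (jN : (j < N'.+1)%N)).
Qed.

Lemma carleson_dom k N N' a b : (forall K L, `|b K L| <= `|a K L|) ->
  carleson k N N' a -> carleson k N N' b.
Proof.
move=> ba ca F; apply: le_trans (ca F); apply: ler_wmean => x _.
apply: ler_wmean => y _; apply: ler_sum => i _; apply: ler_sum => j _.
rewrite ler_wpM2l// -(real_normK (num_real (b _ _))).
by rewrite -(real_normK (num_real (a _ _))) lerXn2r ?nnegrE.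
Qed.

Lemma eq_carleson k N N' a b : (forall K L, b K L = a K L) ->
  carleson k N N' a -> carleson k N N' b.
Proof. by move=> ba; apply: carleson_dom => K L; rewrite ba. Qed.

Lemma carleson_le k l N N' a : k <= l -> carleson k N N' a -> carleson l N N' a.
Proof.
move=> kl ca F; apply: le_trans (ca F) _; rewrite ler_wpM2r//.
by apply: wmean_ge0 => x _; apply: wmean_ge0.
Qed.

Lemma sum_if_take (G : nat -> R) N M : (N <= M)%N ->
  \sum_(i < M.+1) (if (i <= N)%N then G i else 0) = \sum_(i < N.+1) G i.
Proof.
by move=> NM; rewrite -big_mkcond/= (big_ord_widen_cond M.+1 xpredT G).
Qed.

(** A family of coarse rectangles may be tested on a finer grid. *)
Lemma carleson_mono k N N' M M' a : (N <= M)%N -> (N' <= M')%N ->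
  carleson k M M' a -> carleson k N N' a.
Proof.
move=> NM NM' ca F.
pose F' K L := [&& (size K <= N)%N, (size L <= N')%N & F K L].
have := ca F'.
have E1 x y : size x = M -> size y = M' ->
    sqsum F' a M M' x y = sqsum F a N N' (take N x) (take N' y).
  move=> Mx My; rewrite /sqsum.
  rewrite -(sum_if_take (fun i => \sum_(j < N'.+1) (F (take i (take N x)) (take j (take N' y)))%:R *
    a (take i (take N x)) (take j (take N' y)) ^+ 2) NM).
  apply: eq_bigr => i _.
  have iM : (i <= M)%N by rewrite -ltnS.
  rewrite -(sum_if_take (fun j => (F (take i (take N x)) (take j (take N' y)))%:R *
    a (take i (take N x)) (take j (take N' y)) ^+ 2) NM').
  case: ifPn => iN; last first.
    by rewrite big1// => j _; rewrite /F' size_takel ?Mx// (negbTE iN) mul0r.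
  apply: eq_bigr => j _; have jM : (j <= M')%N by rewrite -ltnS.
  rewrite /F' !size_takel ?Mx ?My// iN /=; case: ifPn => jN; last by rewrite mul0r.
  by rewrite !take_takel.
have E2 x y : size x = M -> size y = M' ->
    hits F' M M' x y = hits F N N' (take N x) (take N' y).
  move=> Mx My; apply/hitsP/hitsP => [[i [j []]]|[i [j [iN jN Fij]]]].
    move=> iM jM; rewrite /F' !size_takel ?Mx ?My// => /and3P[iN jN Fij].
    by exists i, j; rewrite !take_takel.
  have iM := leq_trans iN NM; have jM := leq_trans jN NM'.
  exists i, j; split => //; rewrite !take_takel// in Fij.
  by rewrite /F' !size_takel ?Mx ?My// iN jN.
set A := wmean M _; set B := wmean M _.
set A' := wmean N _; set B' := wmean N _.
suff [-> ->] : A = A' /\ B = B' by [].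
split; [rewrite /A' -(wmean_take _ NM) | rewrite /B' -(wmean_take _ NM)];
  apply: eq_wmean => x Mx; [rewrite -(wmean_take _ NM')|rewrite -(wmean_take _ NM')];
  apply: eq_wmean => y My; [exact: E1|by rewrite E2].
Qed.

(** The first digit of a point splits off because no term comes from the whole
    interval; this is what makes induction on the grid possible. *)
Lemma sqsum_cons F a N N' d x y : (forall L, F [::] L -> a [::] L = 0) ->
  sqsum F a N.+1 N' (d :: x) y =
  sqsum (fun K => F (d :: K)) (fun K => a (d :: K)) N N' x y.
Proof.
move=> a0; rewrite /sqsum big_ord_recl /= big1 ?add0r => [|j _]; last first.
  by case: (boolP (F _ _)) => [/a0 ->|_]; rewrite ?expr0n ?mulr0 ?mul0r.
by apply: eq_bigr.
Qed.

Lemma carleson_cons k N N' a d :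
  carleson k N.+1 N' a -> carleson k N N' (fun K => a (d :: K)).
Proof.
move=> ca F.
pose F' K L := if K is d' :: K' then (d' == d) && F K' L else false.
have F'0 L : F' [::] L -> a [::] L = 0 by [].
have Fd d' K L : F' (d' :: K) L = (d' == d) && F K L by [].
have := ca F'; rewrite /=.
have E1 d' x y : sqsum F' a N.+1 N' (d' :: x) y =
   (d' == d)%:R * sqsum F (fun K => a (d :: K)) N N' x y.
  rewrite sqsum_cons//; case: eqVneq => [->|dd]; rewrite ?mul1r ?mul0r.
    by apply: eq_bigr => i _; apply: eq_bigr => j _; rewrite Fd eqxx.
  by rewrite /sqsum big1// => i _; rewrite big1// => j _; rewrite Fd (negbTE dd) mul0r.
have E2 d' x y : (hits F' N.+1 N' (d' :: x) y)%:R =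
   (d' == d)%:R * (hits F N N' x y)%:R :> R.
  rewrite -natrM mulnb; congr (nat_of_bool _)%:R.
  apply/hitsP/andP => [[[|i] [j [iN jN]]] //|[dd /hitsP[i [j [iN jN Fij]]]]].
    by move=> /= /andP[dd Fij]; split => //; apply/hitsP; exists i, j.
  by exists i.+1, j; rewrite ltnS iN jN /= dd.
have W (G' G : word -> word -> R) d' : (forall x y, G' x y = (d' == d)%:R * G x y) ->
    wmean N (fun x => wmean N' (G' x)) =
    (d' == d)%:R * wmean N (fun x => wmean N' (G x)).
  move=> GG; rewrite -wmeanZ; apply: eq_wmean => x _.
  by rewrite -wmeanZ; apply: eq_wmean => y _.
rewrite !(W _ _ _ (E1 _)) !(W _ _ _ (E2 _)).
by case: d {ca F' F'0 Fd E1 E2 W} => /=; lra.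
Qed.

(** The inequality is scale invariant in the first variable: the families inside
    the vertical strip over the interval r are rescaled ones. *)
Lemma carleson_root k a r : (forall N N', carleson k N N' a) ->
  forall N N', carleson k N N' (fun K => a (r ++ K)).
Proof.
elim: r a => [|d r IH] a ca //= N N'.
by apply: (IH (fun K => a (d :: K))) => M M'; apply: carleson_cons.
Qed.

(** The words 0, 10, 110, ... stand for dyadic intervals that partition [0, 1). *)
Definition strip_root nu : word := rcons (nseq nu true) false.

(** A series that lives in disjoint vertical strips has the supremum of the norms
    of its parts as its norm: for every family of rectangles, the inequalities in
    the strips add up, because the parts of the union are disjoint. *)
Lemma carleson_strips k N N' a : 0 <= k ->
  (forall nu M, carleson k M N' (fun K => a (strip_root nu ++ K))) ->
  (forall nu L, a (nseq nu true) L = 0) -> carleson k N N' a.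
Proof.
move=> k0; elim: N a => [|N IH] a cs a0 F.
  rewrite [leLHS](_ : _ = 0).
    by rewrite mulr_ge0//= wmean_ge0.
  rewrite /= -[RHS](wmean_cst N'); apply: eq_wmean => y _.
  by rewrite /sqsum big_ord1 big1// => j _; rewrite (a0 0%N) expr0n mulr0.
have ca d : carleson k N N' (fun K => a (d :: K)).
  case: d; last exact: (cs 0%N).
  by apply: IH => [nu M|nu L]; [exact: (cs nu.+1)|exact: (a0 nu.+1)].
rewrite /= mulrA ler_pM2r ?invr_gt0// mulrDr.
suff step d : wmean N (fun x => wmean N' (sqsum F a N.+1 N' (d :: x))) <=
    k * wmean N (fun x => wmean N' (fun y => (hits F N.+1 N' (d :: x) y)%:R)).
  by apply: lerD; exact: step.
apply: le_trans (le_trans (ca d (fun K => F (d :: K))) _).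
  apply: ler_wmean => x _; apply: ler_wmean => y _.
  by rewrite sqsum_cons// => L _; exact: (a0 0%N).
rewrite ler_wpM2l//; apply: ler_wmean => x _; apply: ler_wmean => y _.
rewrite ler_nat; case: hitsP => // -[i [j [iN jN Fij]]].
by rewrite (introT (hitsP _ _ _ _ _))//; exists i.+1, j.
Qed.

End carleson.

(** * Systems of digits and their block embeddings *)

(** A way of reading a short word in the digits of a long one: the digit j stands
    at the position [dlevel j], and is flipped when the digit j of the twist,
    which depends on the first [dprefix] digits, is set. *)
Record digits := Digits {
  dprefix : nat ;
  dlevel : nat -> nat ;
  dtwist : word -> word }.

Definition digits_ok (s : digits) :=
  (forall i j, (i < j)%N -> (dlevel s i < dlevel s j)%N) /\
  (dprefix s <= dlevel s 0)%N.

Section digits.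
Variables (n : nat) (s : digits).
Implicit Types (x u : word) (N : nat).

Local Notation m := (dlevel s).
Local Notation p := (dprefix s).

(** The j with dlevel j = k, or n.+1 when k is none of the levels up to n. *)
Definition level_index k := index k (mkseq m n.+1).

Definition twist x j := nth false (dtwist s (take p x)) j.

Definition label a x := mkseq (fun j => nth false x (m j) (+) twist x j) a.

(** Overwrites the digits of x, so that u is read in the result. *)
Definition insert N x u :=
  mkseq (fun k => if (level_index k < size u)%N
                  then nth false u (level_index k) (+) twist x (level_index k)
                  else nth false x k) N.

(** The only carrier of the interval u that agrees with x at all positions other
    than those that spell u. *)
Definition carrier x u := take (m (size u)) (insert (m n) x u).

Hypothesis ok : digits_ok s.

Lemma dlevel_lt i j : (i < j)%N -> (m i < m j)%N.
Proof. exact: ok.1. Qed.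

Lemma dlevel_mono i j : (m i < m j)%N = (i < j)%N.
Proof.
case: (ltngtP i j) => [/dlevel_lt -> //|/dlevel_lt|->]; last by rewrite ltnn.
by case: ltngtP.
Qed.

Lemma dlevel_le i j : (i <= j)%N -> (m i <= m j)%N.
Proof. by rewrite leq_eqVlt => /predU1P[->//|/dlevel_lt/ltnW]. Qed.

Lemma dlevel_inj : injective m.
Proof.
move=> i j mij; case: (ltngtP i j) => // /dlevel_lt; by rewrite mij ltnn.
Qed.

Lemma dprefix_le a : (p <= m a)%N.
Proof. exact: leq_trans ok.2 (dlevel_le (leq0n a)). Qed.

Lemma level_index_level a : (a <= n)%N -> level_index (m a) = a.
Proof.
move=> an; rewrite /level_index.
have {1}-> : m a = nth 0%N (mkseq m n.+1) a by rewrite nth_mkseq.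
rewrite index_uniq// ?size_mkseq//.
by rewrite map_inj_uniq ?iota_uniq//; exact: dlevel_inj.
Qed.

Lemma level_level_index k : (level_index k <= n)%N -> m (level_index k) = k.
Proof.
move=> kn; have kin : k \in mkseq m n.+1 by rewrite -index_mem size_mkseq.
by have := nth_index 0%N kin; rewrite nth_mkseq.
Qed.

Lemma size_label a x : size (label a x) = a.
Proof. by rewrite size_mkseq. Qed.

Lemma size_insert N x u : size (insert N x u) = N.
Proof. by rewrite size_mkseq. Qed.

Lemma take_label a b x : (a <= b)%N -> take a (label b x) = label a x.
Proof.
move=> ab; apply: (@eq_from_nth _ false); rewrite size_takel ?size_label// => j ja.
by rewrite nth_take// !nth_mkseq// (leq_trans ja).
Qed.

Lemma twist_take M x j : (p <= M)%N -> twist (take M x) j = twist x j.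
Proof. by move=> pM; rewrite /twist take_takel. Qed.

Lemma label_take a x : label a (take (m a) x) = label a x.
Proof.
apply: (@eq_from_nth _ false); rewrite !size_label// => j ja.
by rewrite !nth_mkseq// nth_take ?dlevel_lt// twist_take// dprefix_le.
Qed.

Lemma label_take_level_index i x : (level_index i <= n)%N ->
  label (level_index i) (take i x) = take (level_index i) (label n x).
Proof.
by move=> il; rewrite take_label// -[RHS]label_take level_level_index.
Qed.

Lemma take_prefix_insert N x u : size x = N -> (p <= N)%N -> (size u <= n)%N ->
  take p (insert N x u) = take p x.
Proof.
move=> Nx pN un; apply: (@eq_from_nth _ false).
  by rewrite !size_takel ?size_insert ?Nx.
rewrite size_takel ?size_insert// => j jp; rewrite !nth_take// nth_mkseq ?(leq_trans jp)//.
case: ltnP => // jn; have := dprefix_le (level_index j).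
by rewrite level_level_index ?(leq_trans (ltnW jn))// leqNgt jp.
Qed.

Lemma twist_insert N x u j : size x = N -> (p <= N)%N -> (size u <= n)%N ->
  twist (insert N x u) j = twist x j.
Proof. by move=> ? ? ?; rewrite /twist take_prefix_insert. Qed.

Lemma label_insert N x u : size x = N -> (m n <= N)%N -> (size u <= n)%N ->
  label (size u) (insert N x u) = u.
Proof.
move=> Nx nN un; apply: (@eq_from_nth _ false); rewrite size_label// => j ju.
have jn := leq_trans ju un.
rewrite nth_mkseq// nth_mkseq; last by rewrite (leq_trans (dlevel_lt jn)).
rewrite level_index_level ?(ltnW jn)// ju twist_insert ?(leq_trans (dprefix_le n))//.
by rewrite -addbA addbb addbF.
Qed.

Lemma insert_label N x u : size x = N -> (m n <= N)%N -> size u = n ->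
  insert N (insert N x u) (label n x) = x.
Proof.
move=> Nx nN un; apply: (@eq_from_nth _ false); rewrite size_insert ?Nx// => k kN.
rewrite nth_mkseq// size_label twist_insert ?(leq_trans (dprefix_le n)) ?un//.
case: ltnP => kn.
  by rewrite nth_mkseq// level_level_index ?(ltnW kn)// -addbA addbb addbF.
by rewrite nth_mkseq// un ltnNge kn.
Qed.

(** The carrier of a prefix of u is a prefix of the carrier of u: this is the
    nesting of carriers on which both norm estimates rest. *)
Lemma take_insert N x u a : (m n <= N)%N -> (a <= n)%N -> size u = n ->
  take (m a) (insert N x u) = take (m a) (insert N x (take a u)).
Proof.
move=> nN an un; have aN := leq_trans (dlevel_le an) nN.
apply: (@eq_from_nth _ false); rewrite !size_takel ?size_insert// => k ka.
rewrite !nth_take// !nth_mkseq ?(leq_trans ka)// un size_takel ?un//.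
case: ltnP => kn; last by rewrite ltnNge (leq_trans an kn).
have ka' : (level_index k < a)%N by rewrite -dlevel_mono level_level_index// ltnW.
by rewrite ka' nth_take.
Qed.

Lemma insert_take N M x u : (N <= M)%N -> (p <= N)%N ->
  take N (insert M x u) = insert N (take N x) u.
Proof.
move=> NM pN; apply: (@eq_from_nth _ false); first by rewrite size_takel ?size_insert.
rewrite size_takel ?size_insert// => k kN.
by rewrite nth_take// !nth_mkseq ?(leq_trans kN)// twist_take// nth_take.
Qed.

Lemma carrierE N x u a : (m n <= N)%N -> size u = n -> (a <= n)%N ->
  carrier (take (m n) x) (take a u) = take (m a) (insert N x u).
Proof.
move=> nN un an; rewrite /carrier (take_insert x nN)// size_takel ?un//.
by rewrite -(insert_take _ _ nN) ?dprefix_le// take_takel// dlevel_le.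
Qed.

Lemma carrier_take x u a : size u = n -> (a <= n)%N ->
  carrier x (take a u) = take (m a) (insert (m n) x u).
Proof. by move=> un an; rewrite /carrier [RHS]take_insert// size_takel ?un. Qed.

Lemma size_carrier x u : (size u <= n)%N -> size (carrier x u) = m (size u).
Proof. by move=> un; rewrite size_takel// size_insert dlevel_le. Qed.

Lemma level_index_carrier x u : (size u <= n)%N -> level_index (size (carrier x u)) = size u.
Proof. by move=> un; rewrite size_carrier// level_index_level. Qed.

Lemma label_carrier x u : size x = m n -> (size u <= n)%N -> label (size u) (carrier x u) = u.
Proof. by move=> nx un; rewrite label_take label_insert. Qed.

Lemma take_prefix_carrier x u : size x = m n -> (size u <= n)%N ->
  take p (carrier x u) = take p x.
Proof. by move=> nx un; rewrite take_takel ?dprefix_le// take_prefix_insert// dprefix_le. Qed.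

End digits.

Section digits_mean.
Variables (R : realFieldType) (n : nat) (s : digits).
Hypothesis ok : digits_ok s.
Local Notation m := (dlevel s).

(** The label of a uniform word is uniform and independent of the other digits. *)
Lemma wmean_insert N (G : word -> word -> R) : (m n <= N)%N ->
  wmean N (fun x => wmean n (fun u => G (insert n s N x u) u)) =
  wmean N (fun x => G x (label s n x)).
Proof.
move=> nN; apply: wmean_swap => [x u Nx nu|x _]; last exact: size_label.
split; [exact: size_insert|by rewrite -{1}nu label_insert ?nu|exact: insert_label].
Qed.

(** Only lengths that are levels contribute to a sum over prefixes of a word. *)
Lemma sum_level_index N (G : nat -> nat -> R) : (m n <= N)%N ->
  \sum_(i < N.+1) (if (level_index n s i <= n)%N then G (level_index n s i) i else 0) =
  \sum_(a < n.+1) G a (m a).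
Proof.
move=> nN; rewrite -big_mkcond/=.
have lN (a : 'I_n.+1) : (m a < N.+1)%N.
  by rewrite ltnS (leq_trans _ nN)// dlevel_le// -ltnS.
rewrite (reindex_onto (fun a : 'I_n.+1 => Ordinal (lN a))
  (fun i : 'I_N.+1 => inord (level_index n s i)))/=; last first.
  by move=> i il; apply: val_inj; rewrite /= inordK ?ltnS// level_level_index.
apply: eq_big => [a|a _]; last by rewrite level_index_level// -ltnS.
by rewrite level_index_level ?leq_ord//=; apply/eqP; rewrite inord_val.
Qed.

End digits_mean.

Section embedding.
Variables (R : realFieldType) (n : nat) (s t : digits) (th : word -> word -> bool).
Hypotheses (sok : digits_ok s) (tok : digits_ok t).
Implicit Types (f g : word -> word -> R) (k : R).
Local Notation m := (dlevel s).
Local Notation m' := (dlevel t).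

(** Puts the coefficient of I x J, up to sign, on all carriers of I x J. *)
Definition embed f K L : R :=
  if (level_index n s (size K) <= n)%N && (level_index n t (size L) <= n)%N then
    (-1) ^+ th K L * f (label s (level_index n s (size K)) K) (label t (level_index n t (size L)) L)
  else 0.

(** The signed average of g over the carriers of I x J; the words x and y that
    supply the other digits range over the same measure for all I and J. *)
Definition project g I J : R :=
  wmean (m n) (fun x => wmean (m' n) (fun y =>
    (-1) ^+ th (carrier n s x I) (carrier n t y J) * g (carrier n s x I) (carrier n t y J))).

Lemma project_embed f I J : (size I <= n)%N -> (size J <= n)%N -> project (embed f) I J = f I J.
Proof.
move=> nI nJ; rewrite /project -[RHS](wmean_cst (m n)); apply: eq_wmean => x mx.
rewrite -[RHS](wmean_cst (m' n)); apply: eq_wmean => y my.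
rewrite /embed !level_index_carrier// nI nJ /= !label_carrier//.
by rewrite mulrA -expr2 sqrr_sign mul1r.
Qed.

Let sum_level_index2 N N' (G : nat -> nat -> nat -> nat -> R) :
  (m n <= N)%N -> (m' n <= N')%N ->
  \sum_(i < N.+1) \sum_(j < N'.+1)
    (if (level_index n s i <= n)%N && (level_index n t j <= n)%N
     then G (level_index n s i) i (level_index n t j) j else 0) =
  \sum_(a < n.+1) \sum_(b < n.+1) G a (m a) b (m' b).
Proof.
move=> nN nN'.
rewrite -(sum_level_index sok (fun a i => \sum_(b < n.+1) G a i b (m' b)) nN).
apply: eq_bigr => i _; rewrite -(sum_level_index tok (G (level_index n s i) i) nN').
by case: ifP => //= _; rewrite big1.
Qed.

(** For fixed x and y the carriers of the I x J, with the remaining digits from x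
    and y, form a copy of the dyadic rectangles.  The inequality for f applies to the
    rectangles whose copies are in F, and [wmean_insert] averages over x and y. *)
Lemma carleson_embed k f : 0 <= k -> carleson k n n f ->
  forall N N', carleson k N N' (embed f).
Proof.
move=> k0 cf N N'.
suff {N N'} H N N' : (m n <= N)%N -> (m' n <= N')%N -> carleson k N N' (embed f).
  apply: (@carleson_mono _ k N N' (N + m n) (N' + m' n)); rewrite ?leq_addr//.
  by apply: H; rewrite leq_addl.
move=> nN nN' F.
pose H x y := \sum_(a < n.+1) \sum_(b < n.+1)
  (F (take (m a) x) (take (m' b) y))%:R * f (take a (label s n x)) (take b (label t n y)) ^+ 2.
have E1 x y : size x = N -> size y = N' -> sqsum F (embed f) N N' x y = H x y.
  move=> Nx Ny; rewrite /H.
  rewrite -(sum_level_index2 (fun a i b j => (F (take i x) (take j y))%:R *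
    f (take a (label s n x)) (take b (label t n y)) ^+ 2) nN nN').
  apply: eq_bigr => i _; apply: eq_bigr => j _; rewrite /embed !size_takel ?Nx ?Ny ?leq_ord//.
  case: ifP => [/andP[il jl]|_]; last by rewrite expr0n mulr0.
  by rewrite exprMn sqrr_sign mul1r !label_take_level_index.
pose H2 x y := [exists a : 'I_n.+1, [exists b : 'I_n.+1,
  F (take (m a) x) (take (m' b) y)]].
have E2 x y : H2 x y -> hits F N N' x y.
  move=> /existsP[a /existsP[b Fab]]; apply/hitsP; exists (m a), (m' b).
  by rewrite (leq_trans _ nN) ?(leq_trans _ nN')// dlevel_le// -ltnS.
apply: (@le_trans _ _ (wmean N (fun x => wmean N' (H x)))).
  by apply: ler_wmean => x Nx; apply: ler_wmean => y Ny; rewrite E1.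
apply: (@le_trans _ _ (k * wmean N (fun x => wmean N' (fun y => (H2 x y)%:R)))); last first.
  rewrite ler_wpM2l//; apply: ler_wmean => x _; apply: ler_wmean => y _.
  by rewrite ler_nat; case: (boolP (H2 x y)) => // /E2 ->.
have sw (G : word -> word -> word -> word -> R) :
    wmean N (fun x => wmean N' (fun y => G x y (label s n x) (label t n y))) =
    wmean N (fun x => wmean N' (fun y => wmean n (fun u => wmean n (fun v =>
      G (insert n s N x u) (insert n t N' y v) u v)))).
  rewrite -(wmean_insert sok (fun x u => wmean N' (fun y => G x y u (label t n y))))//.
  apply: eq_wmean => x _; rewrite [RHS]exchange_wmean; apply: eq_wmean => u _.
  by rewrite (wmean_insert tok (fun y v => G (insert n s N x u) y u v)).
rewrite (sw (fun x y u v => \sum_(a < n.+1) \sum_(b < n.+1)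
  (F (take (m a) x) (take (m' b) y))%:R * f (take a u) (take b v) ^+ 2)).
rewrite (sw (fun x y u v => (H2 x y)%:R)) -wmeanZ.
apply: ler_wmean => x Nx; rewrite -wmeanZ; apply: ler_wmean => y Ny.
have := cf (fun I J => F (carrier n s (take (m n) x) I) (carrier n t (take (m' n) y) J)).
congr (_ <= _ * _); apply: eq_wmean => u nu; apply: eq_wmean => v nv.
  apply: eq_bigr => a _; apply: eq_bigr => b _.
  by rewrite !(carrierE sok (N:=N)) ?(carrierE tok (N:=N')) ?leq_ord.
congr (nat_of_bool _)%:R; apply: eq_existsb => a; apply: eq_existsb => b.
by rewrite !(carrierE sok (N:=N)) ?(carrierE tok (N:=N')) ?leq_ord.
Qed.

(** By the Cauchy-Schwarz inequality the square of a projected coefficient is at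
    most the average of g^2 over the carriers.  If I x J is in F, then its carriers are
    contained in the set of points whose labels lie in the union of F, and this set
    has the same measure as that union. *)
Lemma carleson_project k g : 0 <= k -> carleson k (m n) (m' n) g ->
  carleson k n n (project g).
Proof.
move=> k0 cg F.
set N := m n in cg *; set N' := m' n in cg *.
pose F' K L := [&& (level_index n s (size K) <= n)%N, (level_index n t (size L) <= n)%N &
  F (label s (level_index n s (size K)) K) (label t (level_index n t (size L)) L)].
pose H x y u v := \sum_(a < n.+1) \sum_(b < n.+1)
  (F (take a u) (take b v))%:R * g (take (m a) x) (take (m' b) y) ^+ 2.
have sw (G : word -> word -> word -> word -> R) :
    wmean N (fun x => wmean N' (fun y => G x y (label s n x) (label t n y))) =
    wmean n (fun u => wmean n (fun v => wmean N (fun x => wmean N' (fun y =>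
      G (insert n s N x u) (insert n t N' y v) u v)))).
  rewrite -(wmean_insert sok (fun x u => wmean N' (fun y => G x y u (label t n y))))//.
  rewrite exchange_wmean; apply: eq_wmean => u _; rewrite [RHS]exchange_wmean.
  apply: eq_wmean => x _; rewrite [RHS]exchange_wmean.
  by rewrite (wmean_insert tok (fun y v => G (insert n s N x u) y u v)).
have E1 x y : size x = N -> size y = N' ->
    sqsum F' g N N' x y = H x y (label s n x) (label t n y).
  move=> Nx Ny; rewrite /H.
  rewrite -(sum_level_index2 (fun a i b j => (F (take a (label s n x)) (take b (label t n y)))%:R *
     g (take i x) (take j y) ^+ 2) (leqnn _) (leqnn _)).
  apply: eq_bigr => i _; apply: eq_bigr => j _.
  rewrite /F' !size_takel ?Nx ?Ny ?leq_ord// andbA.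
  case: ifP => [/andP[il jl]|_]; last by rewrite mul0r.
  by rewrite /= !label_take_level_index.
have E2 x y : size x = N -> size y = N' ->
    hits F' N N' x y -> hits F n n (label s n x) (label t n y).
  move=> Nx Ny /hitsP[i [j [iN jN]]]; rewrite /F' !size_takel ?Nx ?Ny//.
  move=> /and3P[il jl]; rewrite !label_take_level_index// => Fij.
  by apply/hitsP; exists (level_index n s i), (level_index n t j).
apply: (@le_trans _ _ (wmean n (fun u => wmean n (fun v => wmean N (fun x =>
    wmean N' (fun y => H (insert n s N x u) (insert n t N' y v) u v)))))).
  apply: ler_wmean => u nu; apply: ler_wmean => v nv; rewrite /sqsum /H.
  rewrite (eq_wmean (H := fun x => \sum_(a < n.+1) \sum_(b < n.+1)
    wmean N' (fun y => (F (take a u) (take b v))%:R *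
      g (take (m a) (insert n s N x u)) (take (m' b) (insert n t N' y v)) ^+ 2))); last first.
    by move=> x _; rewrite wmean_sum; apply: eq_bigr => a _; rewrite wmean_sum.
  rewrite wmean_sum; apply: ler_sum => a _; rewrite wmean_sum; apply: ler_sum => b _.
  rewrite (eq_wmean (H := fun x => (F (take a u) (take b v))%:R * wmean N' (fun y =>
      g (take (m a) (insert n s N x u)) (take (m' b) (insert n t N' y v)) ^+ 2))); last first.
    by move=> x _; rewrite wmeanZ.
  rewrite wmeanZ ler_wpM2l//.
  apply: le_trans (wmean_sqr _ _) _; apply: ler_wmean => x Nx.
  apply: le_trans (wmean_sqr _ _) _; apply: ler_wmean => y Ny.
  rewrite exprMn sqrr_sign mul1r.
  have -> : carrier n s x (take a u) = take (m a) (insert n s N x u).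
    by rewrite carrier_take// leq_ord.
  suff <- : carrier n t y (take b v) = take (m' b) (insert n t N' y v) by rewrite lexx.
  by rewrite carrier_take// leq_ord.
rewrite -sw; have := cg F'.
rewrite (eq_wmean (H := fun x => wmean N' (fun y => H x y (label s n x) (label t n y)))); last first.
  by move=> x Nx; apply: eq_wmean => y Ny; exact: E1.
move=> /le_trans; apply; rewrite ler_wpM2l//.
rewrite [leRHS](_ : _ = wmean N (fun x => wmean N' (fun y =>
    (hits F n n (label s n x) (label t n y))%:R))); last first.
  rewrite (sw (fun x y u v => (hits F n n u v)%:R)).
  apply: eq_wmean => u _; apply: eq_wmean => v _.
  by under eq_wmean do rewrite wmean_cst; rewrite wmean_cst.
apply: ler_wmean => x Nx; apply: ler_wmean => y Ny.
by rewrite ler_nat; case: (boolP (hits F' _ _ _ _)) => // /E2 ->.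
Qed.

End embedding.

(** * Dyadic intervals as words *)

Section words_dyadic.

(** The binary expansion of k with j digits, the most significant digit first. *)
Fixpoint word_of (j k : nat) : word :=
  if j is j'.+1 then rcons (word_of j' k./2) (odd k) else [::].

Definition word_value (s : word) : nat := foldl (fun a (b : bool) => (b + a.*2)%N) 0%N s.

Lemma word_value_rcons s b : word_value (rcons s b) = (b + (word_value s).*2)%N.
Proof. by rewrite /word_value foldl_rcons. Qed.

Lemma word_value_lt s : (word_value s < 2 ^ size s)%N.
Proof.
elim/last_ind: s => [|s b IH]//; rewrite word_value_rcons size_rcons expnS.
by case: b; lia.
Qed.

Lemma size_word_of j k : size (word_of j k) = j.
Proof. by elim: j k => [|j IH] k //=; rewrite size_rcons IH. Qed.

Lemma word_valueK s : word_of (size s) (word_value s) = s.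
Proof.
elim/last_ind: s => [|s b IH]//; rewrite word_value_rcons size_rcons /=.
by rewrite half_bit_double IH oddD odd_double oddb addbF.
Qed.

Lemma word_ofK j k : (k < 2 ^ j)%N -> word_value (word_of j k) = k.
Proof.
elim: j k => [|j IH] k /=; first by rewrite expn0 ltnS leqn0 => /eqP ->.
rewrite expnS => kj; rewrite word_value_rcons IH ?odd_double_half//.
by rewrite ltn_half_double -mul2n.
Qed.

Definition itv_of (s : word) : dyadic :=
  Tagged (fun j => 'I_(2 ^ j)) (Ordinal (word_value_lt s)).

Definition word_of_itv (I : dyadic) : word := word_of (tag I) (tagged I).

Lemma itv_ofK : cancel itv_of word_of_itv.
Proof. by move=> s; rewrite /word_of_itv /= word_valueK. Qed.

Lemma dyadic_eq (I J : dyadic) :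
  tag I = tag J -> tagged I = tagged J :> nat -> I = J.
Proof.
case: I J => [i k] [j l] /= ij; case: j / ij l => l kl.
by congr existT; apply: val_inj.
Qed.

Lemma word_of_itvK : cancel word_of_itv itv_of.
Proof.
move=> I; apply: dyadic_eq; rewrite /= ?size_word_of//.
by rewrite word_ofK ?ltn_ord.
Qed.

Lemma size_word_of_itv I : size (word_of_itv I) = tag I.
Proof. exact: size_word_of. Qed.

End words_dyadic.

Section intervals.
Variable R : realType.
Implicit Types (s x z : word) (t : R).

Definition word_itv s : set R := Defs.dyadic_itv R (itv_of s).

Lemma word_itvE s t : word_itv s t =
  ((word_value s)%:R / 2 ^+ size s <= t < (word_value s).+1%:R / 2 ^+ size s) :> Prop.
Proof. by rewrite /word_itv /Defs.dyadic_itv /= in_itv. Qed.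

(** Appending a digit selects a half of the interval. *)
Lemma word_itv_rcons s t : word_itv s t <-> word_itv (rcons s false) t \/ word_itv (rcons s true) t.
Proof.
rewrite !word_itvE !word_value_rcons !size_rcons exprS.
have p2 : (0 < 2 ^+ size s :> R) by rewrite exprn_gt0.
set q := 2 ^+ size s in p2 *; set k := word_value s.
rewrite (_ : (false + k.*2)%N = k.*2) // (_ : (true + k.*2)%N = k.*2.+1) // !invfM !mulrA.
have -> : (k.*2%:R / 2 : R) = k%:R by rewrite -mul2n natrM; field.
have -> : (k.*2.+2%:R / 2 : R) = k.+1%:R by rewrite -doubleS -mul2n natrM; field.
have lt12 : (k%:R / q < k.*2.+1%:R / 2 / q :> R) /\ (k.*2.+1%:R / 2 / q < k.+1%:R / q :> R).
  have e1 : (k.*2.+1%:R = 2 * k%:R + 1 :> R) by rewrite -mul2n -natr1 natrM.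
  have e2 : (k.+1%:R = k%:R + 1 :> R) by rewrite natr1.
  by rewrite !ltr_pM2r ?invr_gt0// e1 e2; split; lra.
split; last by case=> /andP[? ?]; apply/andP; split; lra.
by move=> /andP[? ?]; case: (ltP t (k.*2.+1%:R / 2 / q)) => ?; [left|right]; apply/andP; split; lra.
Qed.

Lemma word_itv_cat s z : word_itv (s ++ z) `<=` word_itv s.
Proof.
elim/last_ind: z => [|z b IH] t; first by rewrite cats0.
by rewrite -rcons_cat => sbt; apply: IH; apply/word_itv_rcons; case: b sbt; [right|left].
Qed.

Lemma word_itv_cover s t M : word_itv s t -> exists2 z, size z = M & word_itv (s ++ z) t.
Proof.
move=> st; elim: M => [|M [z zM zt]]; first by exists [::]; rewrite ?cats0.
have [zt'|zt'] := (word_itv_rcons _ _).1 zt.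
  by exists (rcons z false); rewrite ?size_rcons ?zM// -rcons_cat.
by exists (rcons z true); rewrite ?size_rcons ?zM// -rcons_cat.
Qed.

Lemma word_itv_inj s x t : size s = size x -> word_itv s t -> word_itv x t -> s = x.
Proof.
rewrite !word_itvE => sx; rewrite sx.
have p2 : (0 < 2 ^+ size x :> R) by rewrite exprn_gt0.
rewrite !ler_pdivrMr// !ltr_pdivlMr// => /andP[a b] /andP[c d].
have e : word_value s = word_value x.
  apply/eqP; rewrite eqn_leq; apply/andP.
  by split; rewrite -ltnS -(ltr_nat R); [exact: le_lt_trans a d|exact: le_lt_trans c b].
by rewrite -(word_valueK s) -(word_valueK x) sx e.
Qed.

Lemma word_itv_nil t : word_itv [::] t = (0 <= t < 1) :> Prop.
Proof. by rewrite word_itvE /= expr0 !divr1. Qed.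

Lemma word_itv_dist s t u : word_itv s t -> word_itv s u -> `|u - t| < (2 ^+ size s)^-1.
Proof.
rewrite !word_itvE -(natr1 (word_value s)) mulrDl mul1r => /andP[a b] /andP[c d].
by rewrite ltr_norml; apply/andP; split; lra.
Qed.

Lemma measurable_word_itv s : measurable (word_itv s).
Proof. exact: measurable_itv. Qed.

End intervals.

Arguments word_itv R s : clear implicits.

(** * Areas of finite unions of cells *)

Section mass.
Variable R : realFieldType.

Lemma wmean_prefix N (s : word) : (size s <= N)%N ->
  wmean N (fun x => (prefix s x)%:R) = (2 ^+ size s)^-1 :> R.
Proof.
elim: N s => [|N IH] [|b s] //= sN; rewrite ?expr0 ?invr1//.
  by rewrite !wmean_cst; field.
have E d : wmean N (fun x => ((b == d) && prefix s x)%:R) =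
   (b == d)%:R * (2 ^+ size s)^-1 :> R.
  rewrite -IH// -wmeanZ; apply: eq_wmean => x _.
  by case: (b == d); rewrite ?mul1r ?mul0r.
by rewrite !E exprS invfM; case: b {E} => /=; rewrite ?mul0r ?mul1r ?add0r ?addr0 mulrC.
Qed.

Lemma wmean_prefixes N (G : word -> R) :
  wmean N (fun x => \sum_(i < N.+1) G (take i x)) =
  \sum_(s : N.-bseq bool) (2 ^+ size s)^-1 * G s.
Proof.
under [RHS]eq_bigr => s _ do
  rewrite -(wmean_prefix (size_bseq s)) mulrC -wmeanZ.
rewrite -wmean_sum; apply: eq_wmean => x Nx.
rewrite (bigID (fun s : N.-bseq bool => prefix s x))/= [X in _ = _ + X]big1 ?addr0; last first.
  by move=> s /negbTE ->; rewrite mulr0.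
have sP (i : 'I_N.+1) : (size (take i x) <= N)%N.
  by rewrite size_takel ?Nx leq_ord.
rewrite [RHS](reindex_onto (fun i : 'I_N.+1 => Bseq (sP i)) (fun s => inord (size s)))/=.
  apply: eq_big => [i|i _]; last by rewrite prefix_take mulr1.
  by rewrite prefix_take size_takel ?Nx ?leq_ord//= inord_val eqxx.
move=> s sx; apply: val_inj => /=; rewrite inordK ?ltnS ?size_bseq//.
by apply/eqP; rewrite -prefixE.
Qed.

(** The area of a rectangle is the proportion of cells that extend it, so that a
    sum over rectangles weighted by area is an average over cells. *)
Lemma wmean2_prefixes N N' (G : word -> word -> R) :
  wmean N (fun x => wmean N' (fun y =>
    \sum_(i < N.+1) \sum_(j < N'.+1) G (take i x) (take j y))) =
  \sum_(p : N.-bseq bool * N'.-bseq bool)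
    (2 ^+ size p.1)^-1 * (2 ^+ size p.2)^-1 * G p.1 p.2.
Proof.
rewrite -(pair_bigA _ (fun (s : N.-bseq bool) (s' : N'.-bseq bool) =>
  (2 ^+ size s)^-1 * (2 ^+ size s')^-1 * G s s'))/=.
transitivity (wmean N (fun x => \sum_(i < N.+1)
   wmean N' (fun y => \sum_(j < N'.+1) G (take i x) (take j y)))).
  by apply: eq_wmean => x _; rewrite wmean_sum.
rewrite (wmean_prefixes N (fun s => wmean N' (fun y => \sum_(j < N'.+1) G s (take j y)))).
apply: eq_bigr => s _; rewrite wmean_prefixes mulr_sumr.
by apply: eq_bigr => s' _; rewrite mulrA.
Qed.

End mass.

Lemma fsbig_finType (R : realType) (T : finType) (P : pred T) (F : T -> \bar R) :
  (\sum_(i \in [set i | P i]) F i = \sum_(i | P i) F i)%E.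
Proof.
rewrite (_ : [set i | P i] = [set` enum P]).
  by rewrite -fsbig_seq ?enum_uniq// big_enum.
by apply/seteqP; split=> i /=; rewrite mem_enum.
Qed.

Section carleson_bmo.
Variable R : realType.
Implicit Types (a : dyadic_rect -> R) (c : R).
Local Notation rect p := (itv_of p.1, itv_of p.2).

Definition coefs a K L : R := a (itv_of K, itv_of L).

Lemma rect_setE (K L : word) : rect_set R (itv_of K, itv_of L) = word_itv R K `*` word_itv R L.
Proof. by []. Qed.

Lemma area_word_itv (K L : word) :
  area (word_itv R K `*` word_itv R L) = ((2 ^+ size K)^-1 * (2 ^+ size L)^-1)%:E.
Proof. by rewrite -rect_setE area_rect. Qed.

Lemma measurable_word_itv2 K L :
  measurable (word_itv R K `*` word_itv R L : set (measurableTypeR R * measurableTypeR R)).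
Proof. by apply: measurableX; exact: measurable_word_itv. Qed.

Lemma fsum_rect N N' (P : pred (N.-bseq bool * N'.-bseq bool)) (g : dyadic_rect -> \bar R) :
  (\sum_(Q \in [set rect p | p in [set p | P p]]) g Q = \sum_(p | P p) g (rect p))%E.
Proof.
rewrite fsbig_image; last first.
  move=> p q _ _ e.
  have /(can_inj itv_ofK)/val_inj e1 : itv_of p.1 = itv_of q.1 := congr1 fst e.
  have /(can_inj itv_ofK)/val_inj e2 : itv_of p.2 = itv_of q.2 := congr1 snd e.
  by case: p q e1 e2 {e} => [? ?] [? ?] /= -> ->.
exact: fsbig_finType.
Qed.

Lemma area_cells N N' (V : pred (N.-tuple bool * N'.-tuple bool)) :
  area (\bigcup_(p in [set p | V p]) (word_itv R p.1 `*` word_itv R p.2)) =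
  (wmean N (fun x => wmean N' (fun y =>
     [exists p, [&& V p, val p.1 == x & val p.2 == y]]%:R)))%:E.
Proof.
rewrite /area measure_fin_bigcup//; last first.
  by move=> p _; exact: measurable_word_itv2.
  move=> [x y] [x' y'] _ _ [[s t] [[/= xs yt] [x's y't]]].
  by congr pair; apply: val_inj; [apply: word_itv_inj xs x's|apply: word_itv_inj yt y't];
    rewrite !size_tuple.
  exact: finite_finset.
rewrite fsbig_finType.
rewrite (eq_bigr (fun p => ((2 ^+ N)^-1 * (2 ^+ N')^-1)%:E)); last first.
  by move=> p _; have := area_word_itv p.1 p.2; rewrite /area !size_tuple.
rewrite sumEFin; congr (_%:E); rewrite wmeanE.
under [in RHS]eq_bigr do rewrite wmeanE.
rewrite -[in RHS]mulr_sumr pair_big/= big_mkcond/= mulrA mulr_sumr; apply: eq_bigr => -[x y] _ /=.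
rewrite (_ : [exists _, _] = V (x, y)); first by case: (V _); rewrite ?mulr1 ?mulr0.
apply/existsP/idP => [[[x' y'] /and3P[Vp /eqP ex /eqP ey]]|Vxy]; last first.
  by exists (x, y); rewrite Vxy !eqxx.
by rewrite /= in ex ey; rewrite -(val_inj ex) -(val_inj ey).
Qed.

(** A relatively open set is the countable union of the dyadic rectangles that it
    contains. *)
Lemma measurable_open_in_square (Om : set (R * R)) : open_in_square R Om ->
  measurable (Om : set (measurableTypeR R * measurableTypeR R)).
Proof.
move=> [_ [U [oU ->]]].
suff -> : U `&` unit_square R = \bigcup_(p : word * word)
    (if `[< word_itv R p.1 `*` word_itv R p.2 `<=` U `&` unit_square R >] then
       word_itv R p.1 `*` word_itv R p.2 else set0).
  apply: countable_bigcupT_measurable; first exact: countableP.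
  by move=> p; case: ifP => // _; exact: measurable_word_itv2.
apply/seteqP; split=> [[s t] [Ust [s01 t01]]|st [p _]]; last first.
  by case: ifP => // /asboolP; apply.
have /nbhs_ballP[e /= e0 eU] : nbhs (s, t) U by exact: open_nbhs_nbhs.
have [M Me] : exists M : nat, (2 ^+ M)^-1 < e.
  have [M _ /(_ M (leqnn M)) Me] := near_infty_natSinv_expn_lt (PosNum e0).
  by exists M; move: Me; rewrite /= mul1r.
have s0 : word_itv R [::] s by move: s01; rewrite /= in_itv word_itv_nil.
have t0 : word_itv R [::] t by move: t01; rewrite /= in_itv word_itv_nil.
have [x xM xs] := word_itv_cover M s0; have [y yM yt] := word_itv_cover M t0.
exists (x, y) => //=; case: ifPn => [_|/asboolP[]]; first by split.
move=> [s' t'] [/= xs' yt']; split.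
  apply: eU; split; rewrite /= /ball/= distrC.
    by apply: lt_trans Me; rewrite -xM; exact: word_itv_dist.
  by apply: lt_trans Me; rewrite -yM; exact: word_itv_dist.
have := word_itv_cat xs' (z := x) (s := [::]).
have := word_itv_cat (z := x) (s := [::]) xs'; have := word_itv_cat (z := y) (s := [::]) yt'.
by rewrite !word_itv_nil => t'01 s'01 _; split; rewrite /= in_itv.
Qed.

End carleson_bmo.

(** * The norm of BMO is the Carleson constant *)

Section link.
Variable R : realType.
Implicit Types (a : dyadic_rect -> R) (c : R).
Local Notation rect p := (itv_of p.1, itv_of p.2).

(** A dyadic interval is not open; this open interval contains it, and is longer
    by the factor 1 + d. *)
Definition word_box (d : R) (s : word) : set R :=
  `] ((word_value s)%:R - d) / 2 ^+ size s, (word_value s).+1%:R / 2 ^+ size s [.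

Lemma word_itv_box d s : 0 < d -> word_itv R s `<=` word_box d s.
Proof.
move=> d0 t; rewrite word_itvE /word_box /= in_itv /= => /andP[st ->]; rewrite andbT.
by apply: lt_le_trans st; rewrite ltr_pM2r ?invr_gt0 ?exprn_gt0// ltrBlDr ltrDl.
Qed.

Lemma lebesgue_word_box d s : 0 < d ->
  lebesgue_measure (word_box d s) = ((1 + d) * (2 ^+ size s)^-1)%:E.
Proof.
move=> d0; rewrite /word_box lebesgue_measure_itv /= lte_fin.
have p2 : (0 < 2 ^+ size s :> R) by rewrite exprn_gt0.
have e1 : (word_value s).+1%:R = (word_value s)%:R + 1 :> R by rewrite natr1.
rewrite ifT; first by rewrite -EFinD e1; congr (_%:E); ring.
by rewrite ltr_pM2r ?invr_gt0// e1; lra.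
Qed.

Lemma open_setM (A B : set R) : open A -> open B -> open (A `*` B).
Proof.
move=> oA oB; rewrite (_ : A `*` B = fst @^-1` A `&` snd @^-1` B)//.
by apply: openI; apply: open_comp => //= z _; [exact: cvg_fst|exact: cvg_snd].
Qed.

Lemma word_itv_square (s s' : word) : word_itv R s `*` word_itv R s' `<=` unit_square R.
Proof. exact: (@rect_sub_square R (itv_of s, itv_of s')). Qed.

Lemma word_itv_neq0 s : word_itv R s !=set0.
Proof.
exists ((word_value s)%:R / 2 ^+ size s); rewrite word_itvE lexx/=.
by rewrite ltr_pM2r ?invr_gt0 ?exprn_gt0// ltr_nat.
Qed.

Lemma carleson_mass_le a c Om : 0 <= c -> (bmo_norm a <= c%:E)%E ->
  open_in_square R Om -> (0 < area Om)%E -> area Om \is a fin_num ->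
  (carleson_mass a Om <= (c ^+ 2)%:E * area Om)%E.
Proof.
move=> c0 ac oOm Om0 Omf; have := bmo_norm_ge0 a; move: ac.
rewrite unlock; set m := ereal_sup _ => mc _.
have cE : (c%:E = sqrte (c ^+ 2)%:E :> \bar R)%E by rewrite /= sqrtr_sqr ger0_norm.
rewrite cE lee_sqrt ?lee_fin ?sqr_ge0// in mc.
have : (carleson_mass a Om / area Om <= (c ^+ 2)%:E)%E.
  by apply: le_trans mc; apply: ereal_sup_ubound; exists Om.
case: (area Om) Om0 Omf => [r||]//; rewrite lte_fin => r0 _.
by rewrite inver gt_eqF// lee_pdivrMr.
Qed.

(** The union of a finite family of dyadic rectangles is not relatively open.  It is
    covered by open boxes around its cells, whose total area exceeds its own by a
    factor (1 + d)^2, and d tends to 0. *)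
Lemma carleson_of_bmo a c : 0 <= c -> (bmo_norm a <= c%:E)%E ->
  forall N N', carleson (c ^+ 2) N N' (coefs a).
Proof.
move=> c0 ac N N' F.
pose V (p : N.-tuple bool * N'.-tuple bool) := hits F N N' p.1 p.2.
have [p0 Vp0|V0] := pickP V; last first.
  have H0 x y : size x = N -> size y = N' -> hits F N N' x y = false.
    move=> /eqP Nx /eqP Ny; exact: (V0 (Tuple Nx, Tuple Ny)).
  rewrite [leLHS](_ : _ = 0).
    by rewrite mulr_ge0 ?sqr_ge0//; apply: wmean_ge0 => x _; apply: wmean_ge0.
  rewrite -[RHS](wmean_cst N); apply: eq_wmean => x Nx.
  rewrite -[RHS](wmean_cst N'); apply: eq_wmean => y Ny.
  rewrite /sqsum big1// => i _; rewrite big1// => j _.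
  case: (boolP (F _ _)) => [Fij|_]; last by rewrite mul0r.
  have /hitsP[] := negbT (H0 x y Nx Ny).
  by exists i, j; rewrite !leq_ord.
set S := wmean N _; set T := wmean N _.
have TE : T = \sum_(p | V p) ((2 ^+ N)^-1 * (2 ^+ N')^-1).
  rewrite /T wmeanE; under eq_bigr do rewrite wmeanE.
  rewrite -[in LHS]mulr_sumr pair_big/= [RHS]big_mkcond/= mulrA mulr_sumr.
  by apply: eq_bigr => -[x y] _; rewrite /V /=; case: (hits _ _ _ _ _); rewrite ?mulr1 ?mulr0.
have T0 : 0 <= T by rewrite TE sumr_ge0// => p _; rewrite mulr_ge0// invr_ge0 exprn_ge0.
have key d : 0 < d -> S <= c ^+ 2 * ((1 + d) ^+ 2 * T).
  move=> d0.
  pose U := \bigcup_(p in [set p | V p]) (word_box d (tval p.1) `*` word_box d (tval p.2)).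
  pose Om := U `&` unit_square R.
  have cellOm p : V p -> word_itv R (tval p.1) `*` word_itv R (tval p.2) `<=` Om.
    move=> Vp; rewrite subsetI; split; last exact: word_itv_square.
    by move=> [s t] [/= /(word_itv_box d0) ? /(word_itv_box d0) ?]; exists p.
  have oOm : open_in_square R Om.
    split.
      have [s0 s0P] := word_itv_neq0 (tval p0.1); have [t0 t0P] := word_itv_neq0 (tval p0.2).
      by exists (s0, t0); apply: (cellOm p0).
    exists U; split => //; apply: bigcup_open => p _.
    by apply: open_setM; exact: interval_open.
  have mOm := measurable_open_in_square oOm.
  have Om_gt0 : (0 < area Om)%E.
    apply: (@lt_le_trans _ _ (area (word_itv R (tval p0.1) `*` word_itv R (tval p0.2)))).
      by rewrite area_word_itv lte_fin mulr_gt0// invr_gt0 exprn_gt0.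
    rewrite /area; apply: le_measure; rewrite ?inE//; last exact: cellOm.
    exact: measurable_word_itv2.
  have Om_le : (area Om <= ((1 + d) ^+ 2 * T)%:E)%E.
    apply: (@le_trans _ _ (\sum_(p \in [set p | V p])
        area (word_box d (tval p.1) `*` word_box d (tval p.2)))%E).
      rewrite /area; apply: content_sub_fsum => //.
      - exact: finite_finset.
      - by move=> p _; apply: measurableX; exact: measurable_itv.
      - exact: subIsetl.
    rewrite fsbig_finType TE mulr_sumr -sumEFin; apply: lee_sum => p _.
    rewrite area_prod; try exact: measurable_itv.
    by rewrite !lebesgue_word_box// -EFinM lee_fin !size_tuple expr2 mulrACA.
  have Om_fin : area Om \is a fin_num.
    by rewrite ge0_fin_numE ?area_ge0// (le_lt_trans Om_le) ?ltry.
  rewrite -lee_fin EFinM.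
  apply: (@le_trans _ _ ((c ^+ 2)%:E * area Om)%E); last first.
    by rewrite lee_wpmul2l ?lee_fin ?sqr_ge0.
  apply: le_trans (carleson_mass_le c0 ac oOm Om_gt0 Om_fin).
  pose P (p : N.-bseq bool * N'.-bseq bool) := F p.1 p.2.
  apply: (@le_trans _ _ (\sum_(Q \in [set rect p | p in [set p | P p]])
      ((a Q ^+ 2)%:E * area (rect_set R Q)))%E); last first.
    apply: ereal_sup_ubound; exists [set rect p | p in [set p | P p]] => //.
    split; first by apply: finite_image; exact: finite_finset.
    move=> _ [p Pp <-] [s t] [/= sp tp].
    have [z zN zs] := word_itv_cover (N - size p.1) sp.
    have [z' zN' zt] := word_itv_cover (N' - size p.2) tp.
    have xN : size (p.1 ++ z) == N by rewrite size_cat zN subnKC ?size_bseq.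
    have yN : size (p.2 ++ z') == N' by rewrite size_cat zN' subnKC ?size_bseq.
    apply: (cellOm (Tuple xN, Tuple yN)); last by split.
    apply/hitsP; exists (size p.1), (size p.2).
    by rewrite !size_bseq /= !take_size_cat.
  rewrite fsum_rect /S (wmean2_prefixes N N' (fun K L => (F K L)%:R * coefs a K L ^+ 2)).
  rewrite [in leRHS]big_mkcond/= -sumEFin le_eqVlt; apply/orP; left.
  apply/eqP; apply: eq_bigr => p _; rewrite /P; case: ifP => _; last by rewrite mul0r mulr0.
  by rewrite area_rect /= -EFinM mul1r mulrC.
rewrite leNgt; apply/negP => ST; have c2 : 0 <= c ^+ 2 by exact: sqr_ge0.
have cT0 : 0 <= c ^+ 2 * T by rewrite mulr_ge0.
set D := c ^+ 2 * T in ST cT0.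
(* With d <= 1, (1 + d)^2 D <= D + 3 d D, which this d keeps below S. *)
pose d := Num.min 1 ((S - D) / (6 * D + 1)).
have D6 : 0 < 6 * D + 1 by lra.
have d0 : 0 < d by rewrite lt_min ltr01 divr_gt0// subr_gt0.
have d1 : d <= 1 by rewrite ge_min lexx.
have dD : d * (6 * D + 1) <= S - D by rewrite -ler_pdivlMr// ge_min lexx orbT.
have := key d d0; rewrite mulrCA -/D.
have : d ^+ 2 * D <= d * D by rewrite ler_wpM2r// expr2 ler_piMl// ltW.
have : 0 <= d * D by rewrite mulr_ge0// ltW.
rewrite sqrrD expr1n mul1r; nra.
Qed.

(** A finite set of rectangles contained in an open set has its union contained
    there, and the finite subsums determine the sum. *)
Lemma bmo_of_carleson a c : 0 <= c ->
  (forall N, carleson (c ^+ 2) N N (coefs a)) -> (bmo_norm a <= c%:E)%E.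
Proof.
move=> c0 ca.
have cE : (c%:E = sqrte (c ^+ 2)%:E :> \bar R)%E by rewrite /= sqrtr_sqr ger0_norm.
rewrite unlock cE lee_sqrt ?lee_fin ?sqr_ge0//.
apply: ge_ereal_sup => _ /= [Om oOm <-].
have mOm := measurable_open_in_square oOm.
suff H : (carleson_mass a Om <= (c ^+ 2)%:E * area Om)%E.
  have [[[s t] Ost] [U [oU OmE]]] := oOm.
  have Om1 : (area Om <= 1)%E.
    rewrite -(area_square R) /area; apply: le_measure; rewrite ?inE//.
      by apply: measurable_open_in_square; exact: open_in_square_square.
    by rewrite OmE; exact: subIsetr.
  have : area Om \is a fin_num by rewrite ge0_fin_numE ?area_ge0// (le_lt_trans Om1) ?ltry.
  have [Om0 _|Om0] := eqVneq (area Om) 0%E.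
    have := H; rewrite Om0 mule0 inve0 => m0.
    have -> : carleson_mass a Om = 0%E.
      apply/eqP; rewrite eq_le m0/=; apply: esum_ge0 => Q _.
      by rewrite mule_ge0 ?area_ge0// lee_fin sqr_ge0.
    by rewrite mul0e lee_fin sqr_ge0.
  have : (0 < area Om)%E by rewrite lt0e Om0 area_ge0.
  case: (area Om) H => [r||]//; rewrite lte_fin => H r0 _.
  by rewrite inver gt_eqF// lee_pdivrMr.
apply: ge_ereal_sup => _ /= [D [finD DOm] <-].
have [N ND] : exists N, forall Q, D Q -> (tag Q.1 <= N)%N && (tag Q.2 <= N)%N.
  have [r rD] := (finite_seqP _).1 finD.
  exists (\max_(Q <- r) maxn (tag Q.1) (tag Q.2)) => Q; rewrite rD /= => rQ.
  rewrite -geq_max.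
  by apply: (leq_bigmax_seq (F := fun Q : dyadic_rect => maxn (tag Q.1) (tag Q.2))).
pose F K L := `[< D (itv_of K, itv_of L) >].
pose P (p : N.-bseq bool * N.-bseq bool) := F p.1 p.2.
have -> : D = [set rect p | p in [set p | P p]].
  apply/seteqP; split=> [Q DQ|_ [p /asboolP Pp <-]//].
  have /andP[n1 n2] := ND Q DQ; rewrite -!size_word_of_itv in n1 n2.
  exists (Bseq n1, Bseq n2); rewrite /P /F /= !word_of_itvK; last by case: (Q).
  by apply/asboolP; case: (Q) DQ.
rewrite fsum_rect.
apply: (@le_trans _ _ (wmean N (fun x => wmean N (sqsum F (coefs a) N N x)))%:E).
  rewrite (wmean2_prefixes N N (fun K L => (F K L)%:R * coefs a K L ^+ 2)).
  rewrite [in leLHS]big_mkcond/= -sumEFin le_eqVlt; apply/orP; left.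
  apply/eqP; apply: eq_bigr => p _; rewrite /P; case: ifP => _; last by rewrite mul0r mulr0.
  by rewrite area_rect /= -EFinM mul1r mulrC.
apply: (@le_trans _ _ ((c ^+ 2)%:E *
    (wmean N (fun x => wmean N (fun y => (hits F N N x y)%:R)))%:E)%E).
  by rewrite -EFinM lee_fin; exact: ca.
rewrite lee_wpmul2l ?lee_fin ?sqr_ge0//.
pose V (p : N.-tuple bool * N.-tuple bool) := hits F N N p.1 p.2.
apply: (@le_trans _ _ (area (\bigcup_(p in [set p | V p]) (word_itv R p.1 `*` word_itv R p.2)))).
  rewrite area_cells lee_fin; apply: ler_wmean => x /eqP Nx; apply: ler_wmean => y /eqP Ny.
  rewrite ler_nat; case: (boolP (hits F N N x y)) => // h.
  rewrite (introT existsP)//; exists (Tuple Nx, Tuple Ny).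
  by rewrite /V /= h !eqxx.
rewrite /area; apply: le_measure; rewrite ?inE//.
  apply: fin_bigcup_measurable; first exact: finite_finset.
  by move=> p _; exact: measurable_word_itv2.
move=> [s t] [p /hitsP[i [j [iN jN /asboolP Dij]]] [/= ps pt]].
apply: (DOm _ Dij); split => /=.
  by apply: (@word_itv_cat R _ (drop i p.1)); rewrite cat_take_drop.
by apply: (@word_itv_cat R _ (drop j p.2)); rewrite cat_take_drop.
Qed.

End link.

(** * Haar coefficients and limits along an ultrafilter *)

Section bmo.
Variable R : realType.
Implicit Types (f g : BMO R) (phi : word -> word -> R) (K L : word).

Lemma bmo_norm_fin f : bmo_norm f = `|f|%:E.
Proof. by rewrite -bmo_fine_normE. Qed.

Lemma carleson_norm f N N' : carleson (`|f| ^+ 2) N N' (coefs f).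
Proof. by apply: carleson_of_bmo => //; rewrite bmo_norm_fin. Qed.

(** The element of BMO with coefficients phi, if their norm is finite; the default
    value 0 is used otherwise. *)
Definition bmo_of phi : BMO R :=
  insubd (0 : BMO R) (fun Q => phi (word_of_itv Q.1) (word_of_itv Q.2)).

Lemma coefs_bmo_of c phi : 0 <= c -> (forall N, carleson (c ^+ 2) N N phi) ->
  coefs (bmo_of phi) = phi /\ `|bmo_of phi| <= c.
Proof.
move=> c0 cphi; set a := (fun Q => phi (word_of_itv Q.1) (word_of_itv Q.2)).
have aE : coefs a = phi.
  by apply/funext => K; apply/funext => L; rewrite /coefs /a /= !itv_ofK.
have ac : (bmo_norm a <= c%:E)%E by apply: bmo_of_carleson => // N; rewrite aE.
have afin : a \in @finite_bmo R by rewrite finite_bmoE (le_lt_trans ac) ?ltry.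
have E : bmo_coef (bmo_of phi) = a by rewrite /bmo_of insubdK.
by rewrite E; split => //; rewrite -lee_fin -bmo_norm_fin E.
Qed.

Lemma bmo_ext f g : (forall K L, coefs f K L = coefs g K L) -> f = g.
Proof.
move=> fg; apply: val_inj; apply/funext => -[I J].
by have := fg (word_of_itv I) (word_of_itv J); rewrite /coefs !word_of_itvK.
Qed.

Lemma coefsD f g K L : coefs (f + g) K L = coefs f K L + coefs g K L.
Proof. by []. Qed.

Lemma coefsZ c f K L : coefs (c *: f) K L = c * coefs f K L.
Proof. by []. Qed.

Lemma coefs0 K L : coefs (0 : BMO R) K L = 0.
Proof. by []. Qed.

Lemma coefs_sum (I : Type) (r : seq I) (P : pred I) (F : I -> BMO R) K L :
  coefs (\sum_(i <- r | P i) F i) K L = \sum_(i <- r | P i) coefs (F i) K L.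
Proof.
by apply: (big_morph (fun h : BMO R => coefs h K L)).
Qed.

(** The norm only sees the absolute values of the coefficients. *)
Lemma bmo_norm_dom f phi : (forall K L, `|phi K L| <= `|coefs f K L|) ->
  coefs (bmo_of phi) = phi /\ `|bmo_of phi| <= `|f|.
Proof.
move=> phif; apply: coefs_bmo_of => // N; apply: carleson_dom phif _.
exact: carleson_norm.
Qed.

(** Test the Carleson inequality on a single rectangle. *)
Lemma ler_norm_coefs f K L : `|coefs f K L| <= `|f|.
Proof.
have h := @carleson_norm f (size K) (size L) (fun K' L' => (K' == K) && (L' == L)).
pose w : R := wmean (size K) (fun x => wmean (size L) (fun y => (prefix K x)%:R * (prefix L y)%:R)).
have w0 : 0 < w.
  rewrite /w (eq_wmean (H := fun x => (2 ^+ size L)^-1 * (prefix K x)%:R)); last first.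
    by move=> x _; rewrite wmeanZ wmean_prefix// mulrC.
  by rewrite wmeanZ wmean_prefix// mulr_gt0// invr_gt0 exprn_gt0.
have {h}h : coefs f K L ^+ 2 * w <= `|f| ^+ 2 * w.
  apply: (le_trans (le_trans _ h)).
    rewrite -wmeanZ; apply: ler_wmean => x xK; rewrite -wmeanZ; apply: ler_wmean => y yL.
    rewrite /sqsum (bigD1 ord_max)//= (bigD1 ord_max)//= -[leLHS]addr0 -addrA lerD//.
      rewrite !take_oversize ?xK ?yL// !prefixE !take_oversize ?xK ?yL//.
      case: eqVneq => [->|_]; rewrite ?mul0r ?mulr0//.
      by case: eqVneq => [->|_]; rewrite ?mul0r ?mulr0// !mul1r mulr1.
    rewrite addr_ge0//; first by apply: sumr_ge0 => j _; rewrite mulr_ge0 ?sqr_ge0.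
    by apply: sumr_ge0 => i _; apply: sumr_ge0 => j _; rewrite mulr_ge0 ?sqr_ge0.
  rewrite ler_wpM2l ?sqr_ge0//; apply: ler_wmean => x xK; apply: ler_wmean => y yL.
  case: (boolP (hits _ _ _ _ _)) => [|_]; last by rewrite mulr_ge0.
  move=> /hitsP[i [j [iN jN /andP[/eqP iK /eqP jL]]]].
  by rewrite -{1}iK -{1}jL !prefix_take mulr1.
rewrite ler_pM2r// in h; rewrite -(@ler_pXn2r _ 2)// ?nnegrE//.
by rewrite real_normK// num_real.
Qed.

Definition haar K L : BMO R := bmo_of (fun K' L' => ((K' == K) && (L' == L))%:R).

Lemma sum_take_eq N x K : size x = N -> \sum_(i < N.+1) (take i x == K)%:R <= 1 :> R.
Proof.
move=> xN; apply: (@le_trans _ _ (\sum_(i < N.+1) (i == size K :> nat)%:R)).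
  apply: ler_sum => i _; rewrite ler_nat; case: eqVneq => // <-.
  by rewrite size_takel ?xN ?leq_ord// eqxx.
have [KN|KN] := ltnP (size K) N.+1.
  rewrite (bigD1 (Ordinal KN))//= eqxx big1 ?addr0// => i iK.
  by have /negbTE -> : (i != size K :> nat) by [].
by rewrite big1// => i _; rewrite ltn_eqF// (leq_trans (ltn_ord i)).
Qed.

(** A single rectangle contributes its own area exactly when it is in the family. *)
Lemma carleson_delta N N' K L :
  carleson (1 ^+ 2 : R) N N' (fun K' L' => ((K' == K) && (L' == L))%:R).
Proof.
move=> F; rewrite expr1n mul1r; apply: ler_wmean => x xN; apply: ler_wmean => y yN.
case: (boolP (hits _ _ _ _ _)) => [_|/negP H]; last first.
  rewrite /sqsum big1// => i _; rewrite big1// => j _.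
  case: (boolP (F _ _)) => Fij; last by rewrite mul0r.
  by case: H; apply/hitsP; exists i, j; rewrite !leq_ord.
apply: (@le_trans _ _ ((\sum_(i < N.+1) (take i x == K)%:R) *
                       \sum_(j < N'.+1) (take j y == L)%:R)).
  rewrite mulr_suml; apply: ler_sum => i _; rewrite mulr_sumr; apply: ler_sum => j _.
  by case: (F _ _); case: (_ == K); case: (_ == L);
    rewrite /= ?expr0n ?expr1n ?mulr0 ?mul0r ?mulr1.
by rewrite -[leRHS]mulr1 ler_pM ?sum_take_eq ?sumr_ge0.
Qed.

Lemma coefs_haar K L K' L' : coefs (haar K L) K' L' = ((K' == K) && (L' == L))%:R.
Proof.
have [-> //] := @coefs_bmo_of 1 (fun K' L' => ((K' == K) && (L' == L))%:R) ler01
  (fun N => @carleson_delta N N K L).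
Qed.

Lemma norm_haar K L : `|haar K L| <= 1.
Proof.
by have [] := @coefs_bmo_of 1 (fun K' L' => ((K' == K) && (L' == L))%:R) ler01
  (fun N => @carleson_delta N N K L).
Qed.

End bmo.

(** Limits along this ultrafilter extend the usual limit linearly to all bounded
    sequences. *)
Definition free_ultra : set_system nat := projT1 (cid (ultraFilterLemma eventually_filter)).

#[global] Instance free_ultra_ultra : UltraFilter free_ultra.
Proof. by rewrite /free_ultra; case: cid => ? []. Qed.

Lemma free_ultra_eventually : \oo `<=` free_ultra.
Proof. by rewrite /free_ultra; case: cid => ? []. Qed.

Section ulim.
Variable R : realType.
Implicit Types u v : nat -> R.

Definition ulim u : R := lim (u @ free_ultra).

Definition bounded_seq u := exists M : R, forall n, `|u n| <= M.

Lemma cvg_ulim u : bounded_seq u -> u @ free_ultra --> ulim u.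
Proof.
move=> [M uM].
suff [p up] : exists p : R, u @ free_ultra --> p by apply/cvg_ex; exists p.
have /(_ (u @ free_ultra) _ _)[] := @segment_compact R (- M) M.
  suff : free_ultra (u @^-1` `[- M, M]) by [].
  by apply: filterE => n /=; rewrite in_itv/= -ler_norml.
move=> p [_ clp]; exists p => V /= pV.
have [//|UV] := in_ultra_setVsetC (u @^-1` V) free_ultra_ultra.
by have [x [/= nVx Vx]] := clp (~` V) V UV pV.
Qed.

Lemma ulimE u l : u @ free_ultra --> l -> ulim u = l.
Proof. by move=> ul; apply: cvg_lim. Qed.

Lemma cvg_ulimE u l : u @ \oo --> l -> ulim u = l.
Proof.
move=> ul; apply: ulimE; apply: cvg_trans ul.
exact: cvg_app free_ultra_eventually.
Qed.

Lemma ulimD u v : bounded_seq u -> bounded_seq v ->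
  ulim (fun n => u n + v n) = ulim u + ulim v.
Proof. by move=> /cvg_ulim bu /cvg_ulim bv; apply: ulimE; exact: cvgD. Qed.

Lemma ulimZ c u : bounded_seq u -> ulim (fun n => c * u n) = c * ulim u.
Proof. by move=> /cvg_ulim bu; apply: ulimE; exact: cvgMr. Qed.

Lemma ulim_near u e : bounded_seq u -> 0 < e ->
  free_ultra [set n | `|u n - ulim u| < e].
Proof.
move=> /cvg_ulim/cvgr_dist_lt h e0; near=> n; rewrite /= distrC.
by near: n; exact: h.
Unshelve. all: by end_near. Qed.

Lemma free_ultra_unbounded (A : set nat) N : free_ultra A -> exists2 n, (N <= n)%N & A n.
Proof.
move=> UA; have UN : free_ultra [set n | (N <= n)%N].
  by apply: free_ultra_eventually; exists N.
by have [n [Nn An]] := filter_ex (filterI UN UA); exists n.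
Qed.

Lemma ulim_le u v : bounded_seq u -> bounded_seq v ->
  (exists n0, forall n, (n0 <= n)%N -> u n <= v n) -> ulim u <= ulim v.
Proof.
move=> bu bv [n0 uv]; apply: ler_cvg_to (cvg_ulim bu) (cvg_ulim bv) _.
by apply: free_ultra_eventually; exists n0 => // n /= nn; exact: uv.
Qed.

End ulim.

(** * Choosing levels, and averaging over signs *)

Definition incr (m : nat -> nat) := forall i j, (i < j)%N -> (m i < m j)%N.

Lemma unbounded_incr (P : nat -> Prop) N :
  (forall k, exists2 n, (k <= n)%N & P n) ->
  exists m, [/\ incr m, (N <= m 0)%N & forall a, P (m a)].
Proof.
move=> unb; pose g k := projT1 (cid2 (unb k)).
have gk k : (k <= g k)%N by rewrite /g; case: cid2.
have gP k : P (g k) by rewrite /g; case: cid2.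
pose m a := iter a (fun k => g k.+1) (g N).
have mS a : (m a < m a.+1)%N by exact: gk.
exists m; split => [i j||[|a]]; [|exact: gk|exact: gP|exact: gP].
by apply: (@homo_ltn _ m (fun k l => (k < l)%N)) => // k l r; exact: ltn_trans.
Qed.

Section double_limit.
Variable R : realType.

(** L is the iterated limit along the ultrafilter.  The rows m a are chosen first,
    with their limits close to L; the columns m' b are then taken from the
    intersection of finitely many sets of the ultrafilter. *)
Lemma double_limit (lam : nat -> nat -> R) (M : R) :
  (forall m m', `|lam m m'| <= M) ->
  exists2 L : R, `|L| <= M & forall e N n, 0 < e ->
    exists m m', [/\ incr m /\ (N <= m 0)%N, incr m' /\ (N <= m' 0)%N &
      forall a b, (a <= n)%N -> (b <= n)%N -> `|lam (m a) (m' b) - L| <= e].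
Proof.
move=> lamM; have bl m : bounded_seq (lam m) by exists M.
have cM c : bounded_seq (fun=> c : R) by exists `|c|.
have ulim_cst c : ulim (fun=> c : R) = c by apply: ulimE; exact: cvg_cst.
have ulimM u : (forall n, `|u n| <= M) -> `|ulim u| <= M :> R.
  move=> uM; rewrite ler_norml -[X in X <= _](ulim_cst (- M)) -[X in _ && (_ <= X)](ulim_cst M).
  have bu : bounded_seq u by exists M.
  apply/andP; split; [apply: (ulim_le (cM _) bu)|apply: (ulim_le bu (cM _))];
    by exists 0%N => n _; have := uM n; rewrite ler_norml => /andP[].
pose l m := ulim (lam m).
have lM m : `|l m| <= M by exact: ulimM.
have bL : bounded_seq l by exists M.
exists (ulim l); first exact: ulimM.
move=> e N n e0; have e20 : 0 < e / 2 by rewrite divr_gt0.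
have [m [mi mN mP]] := unbounded_incr N (fun k => free_ultra_unbounded k (ulim_near bL e20)).
have Un : free_ultra [set k | forall a, (a <= n)%N -> `|lam (m a) k - l (m a)| < e / 2].
  elim: n => [|n IH].
    by apply: filterS (ulim_near (bl (m 0%N)) e20) => k mk a; rewrite leqn0 => /eqP ->.
  apply: filterS (filterI IH (ulim_near (bl (m n.+1)) e20)) => k [h1 h2] a.
  by rewrite leq_eqVlt ltnS => /orP[/eqP ->|/h1].
have [m' [mi' mN' mP']] := unbounded_incr N (fun k => free_ultra_unbounded k Un).
exists m, m'; split => // a b an bn.
have h1 := mP' b a an; have h2 : `|l (m a) - ulim l| < e / 2 := mP a.
rewrite [X in `|X|](_ : _ = (lam (m a) (m' b) - l (m a)) + (l (m a) - ulim l)); last by ring.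
apply: le_trans (ler_normD _ _) _; rewrite /= in h1; lra.
Qed.

End double_limit.

Section greedy.
Variable R : realFieldType.

(** A sum of independent centred vectors has a second moment that is the sum of
    theirs.  Instead of averaging, each vector is chosen to have nonpositive inner
    product with the sum of those already chosen. *)
Lemma greedy_choice (T V : finType) (C : eqType) (s : seq C) (v0 : V)
    (y : C -> V -> T -> R) (B : R) :
  uniq s -> (forall c t, \sum_v y c v t = 0) ->
  (forall c v, \sum_t y c v t ^+ 2 <= B) ->
  exists e : C -> V, \sum_t (\sum_(c <- s) y c (e c) t) ^+ 2 <= B * (size s)%:R.
Proof.
move=> + y0 yB; elim: s => [|c s IH] /=.
  by move=> _; exists (fun=> v0); rewrite big1 ?mulr0// => t _; rewrite big_nil expr0n.
move=> /andP[cs /IH[e eB]]; pose z t := \sum_(c <- s) y c (e c) t.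
have [v zv] : exists v, \sum_t z t * y c v t <= 0.
  (* The inner products with z have sum 0 over v, so that they are not all positive. *)
  have [v zv|zv] := pickP (fun v => \sum_t z t * y c v t <= 0); first by exists v.
  have : \sum_v \sum_t z t * y c v t = 0.
    rewrite exchange_big/= big1// => t _.
    by rewrite -mulr_sumr y0 mulr0.
  move/eqP; rewrite psumr_eq0 => [|v _]; last by rewrite ltW// ltNge zv.
  by move=> /allP/(_ v0 (mem_index_enum _))/eqP zv0; move: (zv v0); rewrite zv0 lexx.
exists (fun c' => if c' == c then v else e c').
rewrite (eq_bigr (fun t => z t ^+ 2 + (2 * (z t * y c v t) + y c v t ^+ 2))); last first.
  move=> t _; rewrite big_cons eqxx.
  rewrite (_ : \sum_(j <- s) _ = z t); first by ring.
  rewrite /z big_seq [RHS]big_seq; apply: eq_bigr => d ds.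
  by case: eqVneq ds cs => // -> ->.
rewrite !big_split/= -mulr_sumr -(natr1 (size s)) mulrDr mulr1.
by have := yB c v; rewrite -/(\sum_t z t ^+ 2) in eB *; lra.
Qed.

End greedy.

Section signs.
Variables (R : realFieldType) (T : finType).
Implicit Types (th : {ffun T -> bool}) (c : T -> T -> R) (l : T -> R).
Local Notation chi th t := ((-1) ^+ (th t : bool) : R).

(** A function of the signs that changes its own sign under the flip of one of
    them has mean 0; all moments below reduce to this. *)
Definition flip (t : T) th : {ffun T -> bool} := [ffun u => th u (+) (u == t)].

Lemma flipK t : involutive (flip t).
Proof. by move=> th; apply/ffunP => u; rewrite !ffunE -addbA addbb addbF. Qed.

Lemma sum_flip t (G : {ffun T -> bool} -> R) :
  (forall th, G (flip t th) = - G th) -> \sum_(th : {ffun T -> bool}) G th = 0.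
Proof.
move=> Gt; have : \sum_(th : {ffun T -> bool}) G th = - \sum_(th : {ffun T -> bool}) G th.
  by rewrite {1}(reindex_inj (inv_inj (flipK t))) -sumrN; apply: eq_bigr.
by lra.
Qed.

Lemma chi_flip t u th : chi (flip t th) u = if u == t then - chi th u else chi th u.
Proof.
by rewrite ffunE; case: (th u); case: (u == t); rewrite /= ?expr0 ?expr1 ?opprK.
Qed.

Lemma chi2 th t : chi th t * chi th t = 1.
Proof. by rewrite -expr2 sqrr_sign. Qed.

Lemma sum_chi2 t u :
  \sum_(th : {ffun T -> bool}) chi th t * chi th u = #|{ffun T -> bool}|%:R * (t == u)%:R.
Proof.
have [->|tu] := eqVneq t u.
  rewrite mulr1; under eq_bigr do rewrite chi2.
  by rewrite sumr_const.
rewrite mulr0; apply: (sum_flip (t := t)) => th.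
by rewrite !chi_flip eqxx eq_sym (negbTE tu) mulNr.
Qed.

Lemma sum_chi4 t t' u u' : t != t' -> u != u' ->
  \sum_(th : {ffun T -> bool}) (chi th t * chi th t') * (chi th u * chi th u') =
  #|{ffun T -> bool}|%:R *
    (((t == u) && (t' == u'))%:R + ((t == u') && (t' == u))%:R).
Proof.
move=> tt' uu'.
have [tu|tu] := eqVneq t u.
  rewrite -tu in uu' *; rewrite (negbTE uu') addr0.
  rewrite -sum_chi2; apply: eq_bigr => th _.
  by rewrite mulrACA chi2 mul1r.
rewrite add0r; have [tu'|tu'] := eqVneq t u'.
  rewrite -tu' in uu' *; rewrite -sum_chi2; apply: eq_bigr => th _.
  by rewrite [chi th u * _]mulrC mulrACA chi2 mul1r.
rewrite mulr0; apply: (sum_flip (t := t)) => th.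
rewrite !chi_flip eqxx ![_ == t]eq_sym (negbTE tt') (negbTE tu) (negbTE tu').
by rewrite !mulNr.
Qed.

Lemma linear_signs l :
  \sum_(th : {ffun T -> bool}) (\sum_t chi th t * l t) ^+ 2 =
  #|{ffun T -> bool}|%:R * \sum_t l t ^+ 2.
Proof.
transitivity (\sum_(th : {ffun T -> bool}) \sum_t \sum_u (l t * l u) * (chi th t * chi th u)).
  apply: eq_bigr => th _; rewrite expr2 mulr_suml; apply: eq_bigr => t _.
  by rewrite mulr_sumr; apply: eq_bigr => u _; ring.
rewrite exchange_big/= mulr_sumr; apply: eq_bigr => t _.
rewrite exchange_big/= (bigD1 t)//= [X in _ + X]big1 ?addr0 => [|u ut].
  by rewrite -mulr_sumr sum_chi2 eqxx mulr1 mulrC expr2.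
by rewrite -mulr_sumr sum_chi2 eq_sym (negbTE ut) !mulr0.
Qed.

(** A quadratic form in random signs without its diagonal, so that its mean is 0. *)
Definition quad th c := \sum_t \sum_(u | u != t) chi th t * (chi th u * c t u).

(** Products of signs over two different pairs are orthogonal, so that the second
    moment is the sum of the squares of the coefficients c t u + c u t. *)
Lemma quad_signs c :
  \sum_(th : {ffun T -> bool}) quad th c ^+ 2 <=
  #|{ffun T -> bool}|%:R * (2 * \sum_t \sum_u c t u ^+ 2).
Proof.
pose E := [pred p : T * T | p.2 != p.1].
have qE th : quad th c = \sum_(p | E p) (chi th p.1 * chi th p.2) * c p.1 p.2.
  by rewrite /quad pair_big_dep/=; apply: eq_bigr => p _; rewrite mulrA.
rewrite (eq_bigr (fun th => \sum_(p | E p) \sum_(q | E q) (c p.1 p.2 * c q.1 q.2) *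
    ((chi th p.1 * chi th p.2) * (chi th q.1 * chi th q.2)))); last first.
  move=> th _; rewrite qE expr2 mulr_suml; apply: eq_bigr => p _.
  by rewrite mulr_sumr; apply: eq_bigr => q _; ring.
rewrite exchange_big/=.
apply: (@le_trans _ _ (\sum_(p | E p)
   #|{ffun T -> bool}|%:R * (c p.1 p.2 ^+ 2 + c p.1 p.2 * c p.2 p.1))).
  apply: ler_sum => -[t t'] /= tt'; rewrite eq_sym in tt'.
  have tt := tt'; rewrite eq_sym in tt.
  rewrite exchange_big/= (bigD1 (t, t'))//= (bigD1 (t', t))/=; last first.
    by rewrite tt' xpair_eqE (negbTE tt).
  rewrite [X in _ + (_ + X)]big1 ?addr0 => [|[u u'] /= /andP[/andP[uu' n1] n2]].
    rewrite -!mulr_sumr !sum_chi4//= !eqxx (negbTE tt) (negbTE tt') /=.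
    by rewrite !(addr0, add0r, mulr1) -mulrDl -expr2 mulrC.
  rewrite eq_sym in uu'; rewrite -mulr_sumr sum_chi4//.
  rewrite !xpair_eqE in n1 n2.
  rewrite ![t == _]eq_sym ![t' == _]eq_sym (negbTE n1).
  by rewrite andbC (negbTE n2) addr0 !mulr0.
rewrite -mulr_sumr ler_wpM2l// pair_big/=.
pose S := \sum_(p : T * T) c p.1 p.2 ^+ 2.
have S' : \sum_(p : T * T) c p.2 p.1 ^+ 2 = S.
  by rewrite [RHS](reindex_inj (inv_inj (f := fun p : T * T => (p.2, p.1)) _)) => [|[]].
apply: (@le_trans _ _ (\sum_(p : T * T) (3 / 2 * c p.1 p.2 ^+ 2 + 1 / 2 * c p.2 p.1 ^+ 2))).
  rewrite big_mkcond/=; apply: ler_sum => -[t u] _ /=.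
  have := sqr_ge0 (c t u - c u t); have := sqr_ge0 (c t u); have := sqr_ge0 (c u t).
  by case: ifP => _; rewrite sqrrB; lra.
by rewrite big_split/= -!mulr_sumr S' -/S; lra.
Qed.

(** Finitely many quadratic and linear forms in signs are small at once when the
    sum of their second moments is. *)
Lemma signs_exist (K K' : finType) (c : K -> T -> T -> R) (l : K' -> T -> R) (B : R) :
  \sum_k (2 * \sum_t \sum_u c k t u ^+ 2) + \sum_k \sum_t l k t ^+ 2 <= B ->
  exists th : {ffun T -> bool},
    (forall k, quad th (c k) ^+ 2 <= B) /\
    (forall k, (\sum_t chi th t * l k t) ^+ 2 <= B).
Proof.
move=> cB; pose Q th := \sum_k quad th (c k) ^+ 2 + \sum_k (\sum_t chi th t * l k t) ^+ 2.
have sQ : \sum_(th : {ffun T -> bool}) Q th <= \sum_(th : {ffun T -> bool}) B.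
  rewrite big_split/= sumr_const -mulr_natl.
  apply: le_trans (ler_wpM2l (ler0n _ _) cB).
  rewrite mulrDr; apply: lerD.
    by rewrite exchange_big/= mulr_sumr; apply: ler_sum => k _; exact: quad_signs.
  rewrite exchange_big/= mulr_sumr; apply: ler_sum => k _.
  by rewrite linear_signs.
have [th Qth] : exists th, Q th <= B.
  have [th Qth|Qth] := pickP (fun th => Q th <= B); first by exists th.
  have : \sum_(th : {ffun T -> bool}) B < \sum_(th : {ffun T -> bool}) Q th.
    apply: ltr_sum => [|th _]; last by rewrite ltNge Qth.
    by apply/hasP; exists [ffun=> true]; rewrite ?mem_index_enum.
  by rewrite ltNge sQ.
exists th; split => k; apply: le_trans Qth; rewrite /Q.
  rewrite (bigD1 k)//= -addrA lerDl addr_ge0// ?sumr_ge0// => ? _; exact: sqr_ge0.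
rewrite [X in _ <= _ + X](bigD1 k)//= addrCA lerDl addr_ge0// ?sumr_ge0// => ? _; exact: sqr_ge0.
Qed.

End signs.

(** * Equidistribution of the carriers *)

Definition xorw (u v : word) : word :=
  mkseq (fun j => nth false u j (+) nth false v j) (size u).

Lemma size_xorw u v : size (xorw u v) = size u.
Proof. by rewrite size_mkseq. Qed.

Section twist.
Variable R : realType.

Lemma wmean_xorw N (G : word -> R) u : (size u <= N)%N ->
  wmean N (fun v => G (xorw u v)) = wmean N (fun v => G (take (size u) v)).
Proof.
elim: N G u => [|N IH] G [|b u] //= uN; rewrite -/(wmean N _).
have E d v : xorw (b :: u) (d :: v) = (b (+) d) :: xorw u v.
  by rewrite /xorw /mkseq /= (iotaDl 1 0) -map_comp.
rewrite (eq_wmean (H := fun v => G ((b (+) false) :: xorw u v))) => [|v _]; last by rewrite E.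
rewrite [X in _ + X](eq_wmean (H := fun v => G ((b (+) true) :: xorw u v))) => [|v _];
  last by rewrite E.
rewrite (IH (fun w => G ((b (+) false) :: w)))// (IH (fun w => G ((b (+) true) :: w)))//.
by case: b {E} => //=; rewrite addrC.
Qed.

Variables (n p : nat) (m : nat -> nat).
Hypotheses (mi : incr m) (pm : (p <= m 0)%N).
Local Notation sys e := (Digits p m e).

Lemma twisted_ok e : digits_ok (sys e).
Proof. by []. Qed.

Lemma carrier_const e x I : carrier n (sys e) x I = carrier n (sys (fun=> e (take p x))) x I.
Proof. by []. Qed.

(** With a constant twist, the carrier of I is the untwisted carrier of the
    translate of I by the twist. *)
Lemma carrier_xorw v x I : size v = n -> (size I <= n)%N ->
  carrier n (sys (fun=> v)) x I = carrier n (sys (fun=> [::])) x (xorw I v).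
Proof.
move=> vn In; rewrite /carrier size_xorw; congr take; apply: eq_mkseq => k.
rewrite size_xorw; case: ifP => // lk.
by rewrite nth_mkseq// /twist /= nth_nil addbF.
Qed.

(** Averaging over all twists v translates I through all labels of its length; the
    carriers of all of these are all words of length m_(size I). *)
Lemma wmean_carrier (phi : word -> R) c I : size c = p -> (size I <= n)%N ->
  wmean n (fun v => wmean (m n) (fun x =>
    (take p x == c)%:R * phi (carrier n (sys (fun=> v)) x I))) =
  wmean (m n) (fun x => (take p x == c)%:R * phi (take (m (size I)) x)).
Proof.
move=> cp In; set s := sys (fun=> [::]); have ok := twisted_ok (fun=> [::]).
have pn : (p <= m n)%N by exact: (dprefix_le ok).
transitivity (wmean n (fun v => wmean (m n) (fun x =>
    (take p x == c)%:R * phi (carrier n s x (xorw I v))))).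
  by apply: eq_wmean => v vn; apply: eq_wmean => x _; rewrite carrier_xorw.
rewrite (wmean_xorw (fun w => wmean (m n) (fun x => (take p x == c)%:R * phi (carrier n s x w))))//.
rewrite exchange_wmean.
rewrite -(wmean_insert (s := s) ok (fun x _ => (take p x == c)%:R * phi (take (m (size I)) x))
  (leqnn (m n))).
apply: eq_wmean => x xn; apply: eq_wmean => v vn.
by rewrite (take_prefix_insert ok)// ?vn// (carrier_take ok).
Qed.

(** Each of the 2^p prefixes c gets a twist of its own.  As a function of the
    twist at c, the contribution of the words that begin with c has mean 0 by
    [wmean_carrier], and its size is at most 2 M / 2^p; hence a good choice makes the
    square of the sum of the 2^p contributions at most of order 2^-p. *)
Lemma twist_exists (T : finType) (phi : T -> word -> R) (M : R) :
  (forall t K, `|phi t K| <= M) ->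
  exists e, forall t I, (size I <= n)%N ->
    (wmean (m n) (fun x => phi t (carrier n (sys e) x I)) -
     wmean (m n) (fun x => phi t (take (m (size I)) x))) ^+ 2 <=
    (#|{: T * n.-bseq bool}|%:R * (2 * M) ^+ 2) / 2 ^+ p.
Proof.
move=> phiM; have pn : (p <= m n)%N by exact: (dprefix_le (twisted_ok (fun=> [::]))).
pose q : R := (2 ^+ p)^-1.
pose d (e : word -> word) t I x := phi t (carrier n (sys e) x I) - phi t (take (m (size I)) x).
pose y (c : word) (v : n.-tuple bool) (t : T * n.-bseq bool) :=
  wmean (m n) (fun x => (take p x == c)%:R * d (fun=> tval v) t.1 t.2 x).
pose s := [seq tval c | c <- enum {: p.-tuple bool}].
have us : uniq s by rewrite map_inj_uniq ?enum_uniq//; exact: val_inj.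
have sP c : (c \in s) = (size c == p).
  apply/mapP/eqP => [[c' _ ->]|/eqP cp]; first exact: size_tuple.
  by exists (Tuple cp); rewrite ?mem_enum.
have ss : size s = (2 ^ p)%N by rewrite size_map -cardE card_tuple card_bool.
have y0 c t : c \in s -> \sum_v y c v t = 0.
  rewrite sP => /eqP cp; have := @wmean_carrier (phi t.1) c t.2 cp (size_bseq t.2).
  move=> /eqP; rewrite -subr_eq0 -(wmean_cst n (wmean (m n) _)) -wmeanB wmeanE.
  rewrite mulf_eq0 invr_eq0 expf_eq0 pnatr_eq0 andbF /= => /eqP h; rewrite -[RHS]h.
  apply: eq_bigr => v _; rewrite -wmeanB; apply: eq_wmean => x _.
  by rewrite /d mulrBr.
have yb c v t : c \in s -> y c v t ^+ 2 <= (2 * M * q) ^+ 2.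
  rewrite sP => /eqP cp.
  have : `|y c v t| <= 2 * M * q.
    apply: le_trans (ler_norm_wmean _ _) _.
    have <- : wmean (m n) (fun x => 2 * M * (take p x == c)%:R) = 2 * M * q.
      rewrite wmeanZ; congr (_ * _); rewrite /q -{2}cp -(@wmean_prefix R (m n)) ?cp//.
      by apply: eq_wmean => x _; rewrite prefixE cp.
    apply: ler_wmean => x _; rewrite normrM normr_nat mulrC ler_wpM2r//.
    apply: le_trans (ler_normB _ _) _.
    by rewrite mulr_natl mulr2n lerD.
  move=> h; rewrite -real_normK ?num_real// lerXn2r ?nnegrE//.
  exact: le_trans h.
pose y' c := if c \in s then y c else fun _ _ => 0.
have y'0 c t : \sum_v y' c v t = 0.
  by rewrite /y'; case: ifP => [/y0|_] //; rewrite big1.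
have y'b c v : \sum_t y' c v t ^+ 2 <= #|{: T * n.-bseq bool}|%:R * (2 * M * q) ^+ 2.
  rewrite mulr_natl -sumr_const; apply: ler_sum => t _.
  by rewrite /y'; case: ifP => [/yb//|_]; rewrite expr0n sqr_ge0.
have [e eB] := greedy_choice (nseq_tuple n false) us y'0 y'b.
exists (fun w => tval (e w)) => t I In.
set lhs := wmean _ _ - _.
have lhsE : lhs = \sum_(c <- s) y' c (e c) (t, Bseq In).
  transitivity (\sum_(c <- s) y c (e c) (t, Bseq In)); last first.
    by apply: eq_big_seq => c cs; rewrite /y' cs.
  rewrite /lhs -wmeanB.
  rewrite -wmean_sum; apply: eq_wmean => x xn.
  have xs : take p x \in s by rewrite sP size_takel ?xn.
  rewrite (bigD1_seq (take p x))//= eqxx mul1r big1 ?addr0; first by rewrite /d [in RHS]carrier_const.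
  by move=> c; rewrite eq_sym => /negbTE ->; rewrite mul0r.
rewrite lhsE.
apply: (@le_trans _ _ (#|{: T * n.-bseq bool}|%:R * (2 * M * q) ^+ 2 * (size s)%:R)).
  apply: le_trans eB; rewrite (bigD1 (t, Bseq In))//= lerDl sumr_ge0// => ? _; exact: sqr_ge0.
rewrite ss natrX -/q; set A := #|_|%:R.
have -> : A * (2 * M * q) ^+ 2 * 2 ^+ p = A * (2 * M) ^+ 2 * q * (q * 2 ^+ p) by ring.
by rewrite mulVf ?mulr1// expf_neq0// pnatr_eq0.
Qed.

End twist.

(** * Blocks in a vertical strip *)

(** The number of the strip that contains the interval K, that is, the position of
    the first digit 0; it is meaningful when K has such a digit. *)
Definition strip (K : word) := find negb K.

Lemma strip_root_cat nu K :
  has negb (strip_root nu ++ K) /\ strip (strip_root nu ++ K) = nu.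
Proof. by rewrite /strip /strip_root; elim: nu => [|nu []] //= -> ->. Qed.

Lemma drop_strip_root nu K : drop nu.+1 (strip_root nu ++ K) = K.
Proof. by rewrite drop_size_cat// size_rcons size_nseq. Qed.

Lemma stripP K : has negb K -> K = strip_root (strip K) ++ drop (strip K).+1 K.
Proof.
elim: K => //= -[] K IH /=; last by rewrite drop0.
by move=> /IH KE; rewrite {1}KE.
Qed.

Lemma strip_nseq nu : has negb (nseq nu true) = false.
Proof. by elim: nu. Qed.

Record block_system := BlockSystem {
  first_digits : digits ;
  second_digits : digits ;
  block_sign : word -> word -> bool }.

Definition block_system_ok (sg : block_system) :=
  digits_ok (first_digits sg) /\ digits_ok (second_digits sg).

Section block.
Variable R : realType.
Implicit Types (f g : BMO R) (sg : block_system) (K L I J : word) (A B : pred nat).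

Lemma norm_strips c (phi : word -> word -> R) : 0 <= c ->
  (forall nu N N', carleson (c ^+ 2) N N' (fun K => phi (strip_root nu ++ K))) ->
  (forall nu L, phi (nseq nu true) L = 0) ->
  coefs (bmo_of phi) = phi /\ `|bmo_of phi| <= c.
Proof.
move=> c0 cs phi0; apply: coefs_bmo_of => // N.
by apply: carleson_strips => //; exact: sqr_ge0.
Qed.

(** Copies of f in all strips of A, each with the block basis of its strip; the
    copy in strip nu only uses the coefficients of depth at most nu. *)
Definition block_coefs (sg : nat -> block_system) A f K L : R :=
  if has negb K && A (strip K) then
    let nu := strip K in
    embed nu (first_digits (sg nu)) (second_digits (sg nu)) (block_sign (sg nu))
      (coefs f) (drop nu.+1 K) L
  else 0.

Definition block (sg : nat -> block_system) A f : BMO R := bmo_of (block_coefs sg A f).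

Definition strip_coefs g nu K L : R := coefs g (strip_root nu ++ K) L.

Definition unblock sg n g I J : R :=
  project n (first_digits sg) (second_digits sg) (block_sign sg) (strip_coefs g n) I J.

Section block_theory.
Variable sg : nat -> block_system.
Hypothesis ok : forall nu, block_system_ok (sg nu).

Lemma block_spec A f :
  coefs (block sg A f) = block_coefs sg A f /\ `|block sg A f| <= `|f|.
Proof.
apply: norm_strips => // [nu N N'|nu L]; last by rewrite /block_coefs strip_nseq.
have [ok1 ok2] := ok nu.
have := @carleson_embed R nu _ _ (block_sign (sg nu)) ok1 ok2 _ _ (sqr_ge0 `|f|)
  (carleson_norm f nu nu) N N'.
apply: carleson_dom => K L; rewrite /block_coefs.
have [-> ->] := strip_root_cat nu K; rewrite /= drop_strip_root.
by case: ifP => // _; rewrite normr0.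
Qed.

Lemma norm_block A f : `|block sg A f| <= `|f|.
Proof. by have [] := block_spec A f. Qed.

Lemma coefs_block A f K L : coefs (block sg A f) K L = block_coefs sg A f K L.
Proof. by have [->] := block_spec A f. Qed.

Lemma strip_coefs_block A f nu K L : strip_coefs (block sg A f) nu K L =
  if A nu then
    embed nu (first_digits (sg nu)) (second_digits (sg nu)) (block_sign (sg nu)) (coefs f) K L
  else 0.
Proof.
rewrite /strip_coefs coefs_block /block_coefs.
by have [-> ->] := strip_root_cat nu K; rewrite /= drop_strip_root.
Qed.

Lemma block_linear A : linear (block sg A).
Proof.
move=> c f g; apply: bmo_ext => K L.
rewrite coefsD coefsZ !coefs_block /block_coefs.
case: ifP => _; last by rewrite mulr0 addr0.
rewrite /embed; case: ifP => _; last by rewrite mulr0 addr0.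
rewrite coefsD coefsZ; ring.
Qed.

Lemma blockU A B f : (forall nu, ~~ (A nu && B nu)) ->
  block sg (fun nu => A nu || B nu) f = block sg A f + block sg B f.
Proof.
move=> AB; apply: bmo_ext => K L; rewrite coefsD !coefs_block /block_coefs.
case: (has negb K) => /=; last by rewrite addr0.
by move: (AB (strip K)); case: (A _); case: (B _) => //= _; rewrite ?addr0 ?add0r.
Qed.

Lemma unblock_block A n f I J : A n -> (size I <= n)%N -> (size J <= n)%N ->
  unblock (sg n) n (block sg A f) I J = coefs f I J.
Proof.
move=> An In Jn; have [ok1 ok2] := ok n.
rewrite /unblock -[RHS](project_embed (block_sign (sg n)) ok1 ok2 (coefs f) In Jn).
rewrite /project; apply: eq_wmean => x _; apply: eq_wmean => y _.
by rewrite strip_coefs_block An.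
Qed.

(** The copy in a single strip depends on finitely many coefficients of f. *)
Lemma block_pred1_sum n f :
  block sg (pred1 n) f = \sum_(Q : n.-bseq bool * n.-bseq bool)
    coefs f Q.1 Q.2 *: block sg (pred1 n) (haar R Q.1 Q.2).
Proof.
apply: bmo_ext => K L; rewrite coefs_sum coefs_block /block_coefs.
under eq_bigr do rewrite coefsZ coefs_block /block_coefs.
case: ifP => [/andP[_ /eqP ->]|_]; last by rewrite big1// => Q _; rewrite mulr0.
rewrite /= /embed; case: ifP => [/andP[Kn Ln]|_]; last by rewrite big1// => Q _; rewrite mulr0.
set I := label _ _ _; set J := label _ _ _.
have In : (size I <= n)%N by rewrite size_label.
have Jn : (size J <= n)%N by rewrite size_label.
rewrite (bigD1 (Bseq In, Bseq Jn))//= [X in _ + X]big1 ?addr0.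
  by rewrite coefs_haar !eqxx mulr1 mulrC.
move=> [I' J'] /= IJ; rewrite coefs_haar.
case: eqVneq => [e|_]; last by rewrite !mulr0.
case: eqVneq => [e'|_]; last by rewrite !mulr0.
by case/eqP: IJ; congr pair; apply: val_inj.
Qed.

(** The inequality is available up to depth n, the depth of the blocks in strip n. *)
Lemma carleson_unblock n g :
  carleson (`|g| ^+ 2) n n (unblock (sg n) n g).
Proof.
have [ok1 ok2] := ok n; apply: carleson_project => //.
by apply: carleson_root; exact: carleson_norm.
Qed.

End block_theory.

Lemma unblock_linear sg n I J c f g :
  unblock sg n (c *: f + g) I J = c * unblock sg n f I J + unblock sg n g I J.
Proof.
rewrite /unblock /project -wmeanZ -wmeanD; apply: eq_wmean => x _.
rewrite -wmeanZ -wmeanD; apply: eq_wmean => y _.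
by rewrite /strip_coefs coefsD coefsZ; ring.
Qed.

Lemma unblock_le sg n g I J : `|unblock sg n g I J| <= `|g|.
Proof.
apply: le_trans (ler_norm_wmean _ _) _; rewrite -[leRHS](wmean_cst (dlevel (first_digits sg) n)).
apply: ler_wmean => x _; apply: le_trans (ler_norm_wmean _ _) _.
rewrite -[leRHS](wmean_cst (dlevel (second_digits sg) n)); apply: ler_wmean => y _.
by rewrite normrM normrX normrN1 expr1n mul1r ler_norm_coefs.
Qed.

Lemma bmo_finite_sum f (X : finType) (k l : X -> word) :
  (forall x x', k x = k x' -> l x = l x' -> x = x') ->
  (forall K L, coefs f K L != 0 -> exists x, K = k x /\ L = l x) ->
  f = \sum_x coefs f (k x) (l x) *: haar R (k x) (l x).
Proof.
move=> inj supp; apply: bmo_ext => K L; rewrite coefs_sum.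
under eq_bigr do rewrite coefsZ coefs_haar.
have [f0|/supp[x [-> ->]]] := eqVneq (coefs f K L) 0.
  rewrite f0 big1// => x _; case: eqVneq => [eK|_]; last by rewrite mulr0.
  by case: eqVneq => [eL|_]; rewrite ?mulr0// -eK -eL f0 mul0r.
rewrite (bigD1 x)//= !eqxx mulr1 big1 ?addr0// => y yx.
case: eqVneq => [eK|_]; last by rewrite mulr0.
case: eqVneq => [eL|_]; last by rewrite mulr0.
by rewrite (inj _ _ eK eL) eqxx in yx.
Qed.

End block.

(** * Almost diagonalization in one strip *)

Lemma exists_pow_le (R : realType) (C e : R) N : 0 < e ->
  exists2 p, (N <= p)%N & C / 2 ^+ p <= e.
Proof.
move=> e0; exists (N + Num.truncn (`|C| / e)).+1; first by rewrite ltnW// ltnS leq_addr.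
set p := (N + _).+1; rewrite ler_pdivrMr ?exprn_gt0//.
apply: le_trans (ler_norm _) _; rewrite mulrC -ler_pdivrMr//.
apply: (@le_trans _ _ p%:R); last by rewrite -natrX ler_nat ltnW// ltn_expl.
apply: (@le_trans _ _ (Num.truncn (`|C| / e)).+1%:R); last by rewrite ler_nat ltnS leq_addl.
by apply/ltW/truncnS_gt.
Qed.

Lemma ler_norm_sqr (R : realDomainType) (x e : R) : 0 <= e -> x ^+ 2 <= e ^+ 2 -> `|x| <= e.
Proof.
by move=> e0 xe; rewrite -(@ler_pXn2r _ 2)// ?nnegrE// real_normK// num_real.
Qed.

Lemma sign_cancel (R : comPzRingType) (e a b c : R) :
  e * e = 1 -> e * (a * (e * b * c)) = a * (b * c).
Proof. by move=> ee; transitivity (e * e * (a * (b * c))); [ring|rewrite ee mul1r]. Qed.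

Lemma sign_reorder (R : comPzRingType) (e e' a b c : R) :
  e * (a * (e' * b * c)) = e * (e' * (a * (b * c))).
Proof. by ring. Qed.

Lemma sum_sqr_le (R : realDomainType) (T : finType) (a : T -> R) :
  (forall t, 0 <= a t) -> \sum_t a t ^+ 2 <= (\sum_t a t) ^+ 2.
Proof.
move=> a0; rewrite [leRHS]expr2 mulr_suml; apply: ler_sum => t _.
by rewrite expr2 ler_wpM2l// (bigD1 t)//= lerDl sumr_ge0.
Qed.

Lemma wmean_eq1_le (R : realFieldType) p (c : word) :
  wmean p (fun x => (x == c)%:R) <= (2 ^+ p)^-1 :> R.
Proof.
have [cp|cp] := eqVneq (size c) p.
  rewrite -{2}cp -(@wmean_prefix R p) ?cp//; apply: ler_wmean => x xp.
  by rewrite prefixE take_oversize ?xp ?cp.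
rewrite (eq_wmean (H := fun=> 0)); first by rewrite wmean_cst invr_ge0 exprn_ge0.
by move=> x xp; case: eqVneq => // xc; rewrite -xc xp eqxx in cp.
Qed.

Section system.
Variables (R : realType) (S : {linear BMO R -> BMO R}) (Gam : R).
Hypotheses (Gam0 : 0 <= Gam) (SGam : forall f, `|S f| <= Gam * `|f|).
Variable n : nat.
Local Notation W := (n.-bseq bool).

Lemma S_scale (c : R) (f : BMO R) : S (c *: f) = c *: S f.
Proof. exact: linearZ. Qed.

Lemma coefs_haar_le (K L K' L' : word) : `|coefs (S (haar R K L)) K' L'| <= Gam.
Proof.
apply: le_trans (ler_norm_coefs _ _ _) _; apply: le_trans (SGam _) _.
by rewrite -[leRHS]mulr1 ler_wpM2l// norm_haar.
Qed.

Definition self_entry K L : R := strip_coefs (S (haar R (strip_root n ++ K) L)) n K L.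

(** The diagonal entry of the compression of S at I x J, up to the terms that the
    random signs make small. *)
Definition mean_self_entry (s t : digits) I J := wmean (dlevel s n) (fun x =>
  wmean (dlevel t n) (fun y => self_entry (carrier n s x I) (carrier n t y J))).

(** The levels are chosen by [double_limit] for the averages of the entries over all
    words of given lengths.  The two twists are chosen one after the other, the second
    variable first: its test functions are the averages over the first variable, one
    for each level, and the test functions for the first variable are the averages
    over the carriers in the second, one for each J.  Thus the number of test
    functions does not depend on the levels, and one p serves for both twists. *)
Lemma mean_self_entry_stable : exists2 L, `|L| <= Gam &
  forall e N, 0 < e -> exists s t, [/\ digits_ok s, digits_ok t, (N <= dprefix s)%N &
    forall I J, (size I <= n)%N -> (size J <= n)%N -> `|mean_self_entry s t I J - L| <= e].
Proof.
pose lam m m' := wmean m (fun x => wmean m' (fun y => self_entry x y)).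
have wmean_le N (G : word -> R) : (forall x, `|G x| <= Gam) -> `|wmean N G| <= Gam.
  move=> GG; apply: le_trans (ler_norm_wmean _ _) _.
  by rewrite -[leRHS](wmean_cst N); apply: ler_wmean.
have dG K L : `|self_entry K L| <= Gam by exact: coefs_haar_le.
have [|L LG LP] := @double_limit R lam Gam.
  by move=> m m'; apply: (wmean_le) => x; apply: (wmean_le).
exists L => // e N e0; pose d := e / 3; have d0 : 0 < d by rewrite divr_gt0.
pose C : R := #|{: 'I_n.+1 * W}|%:R * (2 * Gam) ^+ 2.
pose C' : R := #|{: W * W}|%:R * (2 * Gam) ^+ 2.
have [p pN pC] := exists_pow_le (C + C') N (exprn_gt0 2 d0).
have C0 : 0 <= C by rewrite mulr_ge0// sqr_ge0.
have C'0 : 0 <= C' by rewrite mulr_ge0// sqr_ge0.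
have i2 : 0 <= (2 ^+ p)^-1 :> R by rewrite invr_ge0 exprn_ge0.
have pC1 : C / 2 ^+ p <= d ^+ 2 by apply: le_trans pC; rewrite ler_wpM2r// lerDl.
have pC2 : C' / 2 ^+ p <= d ^+ 2 by apply: le_trans pC; rewrite ler_wpM2r// lerDr.
have [m [m' [[mi pm] [mi' pm'] lamL]]] := LP d p n d0.
have [e' e'P] := @twist_exists R n p m' mi' pm' 'I_n.+1
  (fun a K => wmean (m a) (fun x => self_entry x K)) Gam
  (fun a K => wmean_le _ _ (fun x => dG x K)).
pose t := Digits p m' e'.
have [e1 e1P] := @twist_exists R n p m mi pm W
  (fun J K => wmean (m' n) (fun y => self_entry K (carrier n t y J))) Gam
  (fun J K => wmean_le _ _ (fun y => dG K _)).
pose s := Digits p m e1; exists s, t; split => // I J In Jn.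
have sok : digits_ok s by [].
have tok : digits_ok t by [].
have mIn : (m (size I) <= m n)%N := dlevel_le sok In.
have mJn : (m' (size J) <= m' n)%N := dlevel_le tok Jn.
have h1 := ler_norm_sqr (ltW d0) (le_trans (e1P (Bseq Jn) I In) pC2).
have h2 := ler_norm_sqr (ltW d0) (le_trans (e'P (inord (size I)) J Jn) pC1).
have h3 := lamL (size I) (size J) In Jn.
rewrite inordK ?ltnS// in h2.
rewrite (wmean_take (fun K => wmean (m' n) (fun y => self_entry K (carrier n t y J))) mIn)/= in h1.
rewrite (wmean_take (fun K => wmean (m (size I)) (fun x => self_entry x K)) mJn) in h2.
rewrite exchange_wmean in h2.
rewrite [X in _ - X]exchange_wmean -/(lam _ _) in h2.
rewrite -/s -/t in h1 h2; rewrite /mean_self_entry /=.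
set D := wmean _ _ in h1 *; set D1 := wmean _ _ in h1 h2.
rewrite (_ : D - L = (D - D1) + (D1 - lam (m (size I)) (m' (size J))) +
   (lam (m (size I)) (m' (size J)) - L)); last by ring.
apply: le_trans (ler_normD _ _) _.
have := ler_normD (D - D1) (D1 - lam (m (size I)) (m' (size J))).
have : d * 3 = e by rewrite /d divfK// pnatr_eq0.
lra.
Qed.

Section fixed_digits.
Variables (s t : digits).
Hypotheses (sok : digits_ok s) (tok : digits_ok t).
Local Notation m := (dlevel s).
Local Notation m' := (dlevel t).
Local Notation X := ((m n).-bseq bool * (m' n).-bseq bool)%type.

Definition carrier_weight (I J : word) (x : X) : R :=
  wmean (m n) (fun u => wmean (m' n) (fun v =>
    ((carrier n s u I == x.1) && (carrier n t v J == x.2))%:R)).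

Lemma size_carrier_le (d : digits) u I : (size (carrier n d u I) <= dlevel d n)%N.
Proof. by rewrite size_take size_insert; case: ltnP => // /ltnW. Qed.

Lemma carrier_weight_sum (F : word -> word -> R) I J :
  wmean (m n) (fun u => wmean (m' n) (fun v => F (carrier n s u I) (carrier n t v J))) =
  \sum_(x : X) carrier_weight I J x * F x.1 x.2.
Proof.
under eq_bigr do rewrite mulrC -wmeanZ.
rewrite -wmean_sum; apply: eq_wmean => u _.
under [RHS]eq_bigr do rewrite -wmeanZ.
rewrite -wmean_sum; apply: eq_wmean => v _.
rewrite (bigD1 (Bseq (size_carrier_le s u I), Bseq (size_carrier_le t v J)))//= !eqxx mulr1.
rewrite big1 ?addr0// => -[x y] /= xy.
case: eqVneq => [ex|_]; last by rewrite mulr0.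
case: eqVneq => [ey|_]; last by rewrite mulr0.
by case/eqP: xy; congr pair; apply: val_inj.
Qed.

Lemma carrier_weight_ge0 I J x : 0 <= carrier_weight I J x.
Proof. by apply: wmean_ge0 => u _; apply: wmean_ge0. Qed.

(** A carrier determines the first p digits of the word that it comes from. *)
Lemma carrier_weight_le I J x : (size I <= n)%N -> carrier_weight I J x <= (2 ^+ dprefix s)^-1.
Proof.
move=> In; set p := dprefix s; have pn : (p <= m n)%N := dprefix_le sok n.
apply: le_trans (wmean_eq1_le R p (take p x.1)).
rewrite -(wmean_take _ pn); apply: ler_wmean => u un.
rewrite -[leRHS](wmean_cst (m' n)); apply: ler_wmean => v _.
rewrite ler_nat; case: eqVneq => //= ex.
by rewrite -ex (take_prefix_carrier sok)// eqxx; case: eqP.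
Qed.

Lemma carrier_weight_sqr I J : (size I <= n)%N ->
  \sum_(x : X) carrier_weight I J x ^+ 2 <= (2 ^+ dprefix s)^-1.
Proof.
move=> In; have := carrier_weight_sum (fun _ _ => 1) I J.
under eq_wmean do rewrite wmean_cst; rewrite wmean_cst => w1.
apply: (@le_trans _ _ (\sum_(x : X) (2 ^+ dprefix s)^-1 * (carrier_weight I J x * 1))).
  by apply: ler_sum => x _; rewrite mulr1 expr2 ler_wpM2r ?carrier_weight_ge0// carrier_weight_le.
by rewrite -mulr_sumr -w1 mulr1.
Qed.

Definition carries (I' J' K L : word) := [&& (level_index n s (size K) <= n)%N,
  (level_index n t (size L) <= n)%N, label s (level_index n s (size K)) K == I' &
  label t (level_index n t (size L)) L == J'].

Lemma embed_haar th I' J' K L : embed n s t th (coefs (haar R I' J')) K L =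
  (-1) ^+ th K L * (carries I' J' K L)%:R.
Proof.
rewrite /embed /carries coefs_haar andbA; case: ifP => //= _.
by rewrite mulr0.
Qed.

Lemma carries_carrier I J I' J' u v : size u = m n -> size v = m' n ->
  (size I <= n)%N -> (size J <= n)%N ->
  carries I' J' (carrier n s u I) (carrier n t v J) = (I == I') && (J == J').
Proof.
by move=> un vn In Jn; rewrite /carries !level_index_carrier// In Jn !label_carrier.
Qed.

Lemma carries_bseq I' J' K L : carries I' J' K L -> (size K <= m n)%N /\ (size L <= m' n)%N.
Proof.
move=> /and4P[Kn Ln _ _].
by rewrite -{1}(level_level_index Kn) -{1}(level_level_index Ln); split; apply: dlevel_le.
Qed.

Local Notation kx x := (strip_root n ++ (x : X).1).

Definition block_entry (x y : X) : R := strip_coefs (S (haar R (kx y) y.2)) n x.1 x.2.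

Lemma kx_inj (x y : X) : kx x = kx y -> x.2 = y.2 :> word -> x = y.
Proof.
move=> /(congr1 (drop n.+1)); rewrite !drop_strip_root => e1 e2.
by case: x y e1 e2 => [x1 x2] [y1 y2] /= /val_inj -> /val_inj ->.
Qed.

Let sys th : nat -> block_system := fun=> BlockSystem s t th.

Let twisted_ok th nu : block_system_ok (sys th nu). Proof. by []. Qed.

Lemma strip_coefs_block_haar th I' J' K L :
  strip_coefs (block (sys th) (pred1 n) (haar R I' J')) n K L =
  (-1) ^+ th K L * (carries I' J' K L)%:R.
Proof. by rewrite strip_coefs_block//= eqxx embed_haar. Qed.

Lemma block_haar_supp th I' J' K L :
  coefs (block (sys th) (pred1 n) (haar R I' J')) K L != 0 ->
  exists x : X, K = kx x /\ L = x.2.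
Proof.
rewrite coefs_block// /block_coefs; case: ifP => [/andP[hK /eqP sK]|]; last by rewrite eqxx.
rewrite /= sK embed_haar; case: (boolP (carries _ _ _ _)) => [|_]; last by rewrite mulr0 eqxx.
move=> /carries_bseq[k1 k2] _; exists (Bseq k1, Bseq k2); split => //=.
by rewrite {1}(stripP hK) sK.
Qed.

Lemma block_haar_sum th I' J' :
  block (sys th) (pred1 n) (haar R I' J') =
  \sum_(x : X) ((-1) ^+ th x.1 x.2 * (carries I' J' x.1 x.2)%:R) *: haar R (kx x) x.2.
Proof.
rewrite {1}(bmo_finite_sum kx_inj (@block_haar_supp th I' J')).
by apply: eq_bigr => x _; rewrite -strip_coefs_block_haar.
Qed.

(** When the signs of a block are chosen so that nothing cancels, the sum is a
    single coefficient of the image under S of a vector of norm at most 1. *)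
Lemma block_entry_row I' J' x :
  \sum_(y : X) (carries I' J' y.1 y.2)%:R * `|block_entry x y| <= Gam.
Proof.
pose b := block (sys (fun _ _ => false)) (pred1 n) (haar R I' J').
(* The block b with the signs of the entries that are summed. *)
pose phi K L : R := Num.sg (strip_coefs (S (haar R K L)) n x.1 x.2) * `|coefs b K L|.
have phib K L : `|phi K L| <= `|coefs b K L|.
  by rewrite normrM normr_id normr_sg ler_piMl// lern1; case: eqP.
have [phiE phi1] := bmo_norm_dom phib.
have vsum : bmo_of phi = \sum_(y : X) phi (kx y) y.2 *: haar R (kx y) y.2.
  rewrite {1}(@bmo_finite_sum _ (bmo_of phi) _ _ _ kx_inj) ?phiE// => K L.
  by rewrite /phi mulf_eq0 negb_or normr_eq0 => /andP[_ /block_haar_supp].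
have <- : strip_coefs (S (bmo_of phi)) n x.1 x.2 =
    \sum_(y : X) (carries I' J' y.1 y.2)%:R * `|block_entry x y|.
  rewrite vsum (linear_sum S) /strip_coefs coefs_sum; apply: eq_bigr => y _.
  rewrite S_scale coefsZ -/(strip_coefs _ _ _ _) -/(block_entry x y) /phi -/(block_entry x y).
  have -> : `|coefs b (kx y) y.2| = (carries I' J' y.1 y.2)%:R.
    by rewrite -/(strip_coefs b n _ _) strip_coefs_block_haar expr0 mul1r normr_nat.
  by rewrite mulrAC -normrEsg mulrC.
apply: le_trans (ler_norm _) _; apply: le_trans (ler_norm_coefs _ _ _) _.
apply: le_trans (SGam _) _; rewrite -[leRHS]mulr1 ler_wpM2l//.
apply: le_trans phi1 _; apply: le_trans (norm_block _ _ _) _ => //.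
exact: norm_haar.
Qed.

(** The entry of the compression at (I x J, I' x J') is a quadratic form in the
    signs.  Its diagonal is the announced main term.  The squares of its other
    coefficients add up to at most Gam^2 times the sum of the squared weights,
    by [block_entry_row], and the weights are at most 2^-p and have sum 1.
    The projections of the vectors of G are linear forms and are treated likewise. *)
Lemma signs_for_system (G : seq (BMO R)) (B : R) :
  (#|{: (W * W) * (W * W)}|%:R * (2 * Gam ^+ 2) +
   #|{: W * W}|%:R * \sum_(g <- G) `|g| ^+ 2) / 2 ^+ dprefix s <= B ->
  exists th, let sg := BlockSystem s t th in
    (forall g I J, g \in G -> (size I <= n)%N -> (size J <= n)%N ->
       unblock sg n g I J ^+ 2 <= B) /\
    (forall I J I' J', (size I <= n)%N -> (size J <= n)%N ->
       (size I' <= n)%N -> (size J' <= n)%N ->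
       (unblock sg n (S (block (fun=> sg) (pred1 n) (haar R I' J'))) I J -
        ((I == I') && (J == J'))%:R * mean_self_entry s t I J) ^+ 2 <= B).
Proof.
move=> ZB; pose q : R := (2 ^+ dprefix s)^-1.
have q0 : 0 <= q by rewrite invr_ge0 exprn_ge0.
pose c (k : (W * W) * (W * W)) (x y : X) : R :=
  carrier_weight k.1.1 k.1.2 x * ((carries k.2.1 k.2.2 y.1 y.2)%:R * block_entry x y).
pose l (k : 'I_(size G) * (W * W)) (x : X) : R :=
  carrier_weight k.2.1 k.2.2 x * strip_coefs (nth 0 G k.1) n x.1 x.2.
have cB k : 2 * \sum_(x : X) \sum_(y : X) c k x y ^+ 2 <= 2 * Gam ^+ 2 * q.
  rewrite -mulrA ler_wpM2l//.
  apply: (@le_trans _ _ (\sum_(x : X) Gam ^+ 2 * carrier_weight k.1.1 k.1.2 x ^+ 2)).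
    apply: ler_sum => x _; under eq_bigr do rewrite exprMn.
    rewrite -mulr_sumr mulrC ler_wpM2r ?sqr_ge0//.
    apply: (@le_trans _ _ ((\sum_(y : X) (carries k.2.1 k.2.2 y.1 y.2)%:R * `|block_entry x y|) ^+ 2)).
      apply: le_trans (sum_sqr_le _); last by move=> y; rewrite mulr_ge0.
      by apply: ler_sum => y _; rewrite !exprMn real_normK ?num_real.
    rewrite lerXn2r ?nnegrE//; last exact: block_entry_row.
    by apply: sumr_ge0 => y _; rewrite mulr_ge0.
  by rewrite -mulr_sumr ler_wpM2l ?sqr_ge0// carrier_weight_sqr// size_bseq.
have lB k : \sum_(x : X) l k x ^+ 2 <= `|nth 0 G k.1| ^+ 2 * q.
  apply: (@le_trans _ _ (\sum_(x : X) `|nth 0 G k.1| ^+ 2 * carrier_weight k.2.1 k.2.2 x ^+ 2)).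
    apply: ler_sum => x _; rewrite exprMn mulrC ler_wpM2r ?sqr_ge0//.
    by rewrite -real_normK ?num_real// lerXn2r ?nnegrE// ler_norm_coefs.
  by rewrite -mulr_sumr ler_wpM2l ?sqr_ge0// carrier_weight_sqr// size_bseq.
have clB : \sum_k (2 * \sum_(x : X) \sum_(y : X) c k x y ^+ 2) +
    \sum_k \sum_(x : X) l k x ^+ 2 <= B.
  apply: le_trans ZB; rewrite -/q mulrDl; apply: lerD.
    apply: le_trans (ler_sum _ (fun k _ => cB k)) _.
    by rewrite sumr_const -[leLHS]mulr_natl -[leRHS]mulrA.
  apply: le_trans (ler_sum _ (fun k _ => lB k)) _.
  rewrite -mulr_suml ler_wpM2r//.
  rewrite -(pair_bigA _ (fun (i : 'I_(size G)) (_ : W * W) => `|nth 0 G i| ^+ 2))/=.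
  rewrite mulr_sumr (big_nth 0) big_mkord; apply: ler_sum => i _.
  by rewrite sumr_const mulr_natl.
have [th [thc thl]] := signs_exist clB.
pose sgn K L := th (insub_bseq _ K, insub_bseq _ L).
have sgnE (x : X) : sgn x.1 x.2 = th x.
  by rewrite /sgn /insub_bseq !valKd; case: x.
have unblockE g I J : unblock (BlockSystem s t sgn) n g I J =
    \sum_(x : X) (-1) ^+ th x * (carrier_weight I J x * strip_coefs g n x.1 x.2).
  rewrite /unblock /project (carrier_weight_sum (fun K L => (-1) ^+ sgn K L * strip_coefs g n K L)).
  by apply: eq_bigr => x _; rewrite sgnE mulrCA.
exists sgn; split => [g I J gG In Jn|I J I' J' In Jn In' Jn'].
  have gi : (index g G < size G)%N by rewrite index_mem.
  have := thl (Ordinal gi, (Bseq In, Bseq Jn)); rewrite unblockE /l /=.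
  by rewrite nth_index.
have := thc ((Bseq In, Bseq Jn), (Bseq In', Bseq Jn')).
congr (_ ^+ 2 <= _); apply/esym/eqP; rewrite subr_eq addrC; apply/eqP.
have -> : ((I == I') && (J == J'))%:R * mean_self_entry s t I J =
    \sum_(x : X) carrier_weight I J x * ((carries I' J' x.1 x.2)%:R * block_entry x x).
  rewrite -(carrier_weight_sum (fun K L => (carries I' J' K L)%:R * self_entry K L)).
  rewrite /mean_self_entry -wmeanZ.
  apply: eq_wmean => u un; rewrite -wmeanZ; apply: eq_wmean => v vn.
  by rewrite carries_carrier.
rewrite unblockE /quad -big_split/=; apply: eq_bigr => x _.
rewrite (block_haar_sum sgn) (linear_sum S) /strip_coefs coefs_sum mulr_sumr mulr_sumr.
rewrite (bigD1 x)//=; congr (_ + _).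
  rewrite S_scale coefsZ -/(strip_coefs _ _ _ _) -/(block_entry x x) sgnE.
  by apply: sign_cancel; exact: chi2.
apply: eq_bigr => y _; rewrite S_scale coefsZ -/(strip_coefs _ _ _ _) -/(block_entry x y) sgnE /c /=.
exact: sign_reorder.
Qed.

End fixed_digits.

Lemma block_system_exists : exists2 L : R, `|L| <= Gam &
  forall (e : R) (G : seq (BMO R)), 0 < e -> exists sg, [/\ block_system_ok sg,
    (forall g I J, g \in G -> (size I <= n)%N -> (size J <= n)%N ->
       `|unblock sg n g I J| <= e) &
    (forall I J I' J', (size I <= n)%N -> (size J <= n)%N ->
       (size I' <= n)%N -> (size J' <= n)%N ->
       `|unblock sg n (S (block (fun=> sg) (pred1 n) (haar R I' J'))) I J -
        ((I == I') && (J == J'))%:R * L| <= e)].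
Proof.
have [L LG LP] := mean_self_entry_stable; exists L => // e G e0.
have e2 : 0 < e / 2 by rewrite divr_gt0.
set Z := #|{: (W * W) * (W * W)}|%:R * (2 * Gam ^+ 2) +
   #|{: W * W}|%:R * \sum_(g <- G) `|g| ^+ 2.
have [p _ pZ] := exists_pow_le Z 0%N (exprn_gt0 2 e2).
have [s [t [sok tok ps dL]]] := LP (e / 2) p e2.
have Z0 : 0 <= Z.
  by rewrite addr_ge0// mulr_ge0// ?sumr_ge0// ?mulr_ge0// ?sqr_ge0// => g _; exact: sqr_ge0.
have sZ : Z / 2 ^+ dprefix s <= (e / 2) ^+ 2.
  apply: le_trans pZ; rewrite ler_wpM2l// lef_pV2 ?posrE ?exprn_gt0//.
  by rewrite ler_weXn2l// ler1n.
have [th [h1 h2]] := signs_for_system sok tok sZ.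
exists (BlockSystem s t th); split => // [g I J gG In Jn|I J I' J' In Jn In' Jn'].
  by apply: le_trans (ler_norm_sqr (ltW e2) (h1 g I J gG In Jn)) _; lra.
have h := ler_norm_sqr (ltW e2) (h2 I J I' J' In Jn In' Jn').
have d := dL I J In Jn; set U := unblock _ _ _ _ _ in h *.
set D := mean_self_entry _ _ _ _ in h d.
case: (_ && _) h; rewrite ?mul0r ?mul1r => h; last by apply: le_trans h _; lra.
rewrite (_ : U - L = (U - D) + (D - L)); last by ring.
by apply: le_trans (ler_normD _ _) _; lra.
Qed.

End system.

(** * Decoupling the strips *)

Section supports.
Variable R : realType.
Implicit Types (f g : BMO R) (A B : pred nat).

Definition supported A g :=
  forall K L, ~~ (has negb K && A (strip K)) -> coefs g K L = 0.

Lemma supportedS A B g : (forall nu, A nu -> B nu) -> supported A g -> supported B g.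
Proof.
move=> AB gA K L nB; apply: gA; apply: contra nB => /andP[-> /AB ->].
by [].
Qed.

Lemma supported_block (sg : nat -> block_system) A f : (forall nu, block_system_ok (sg nu)) ->
  supported A (block sg A f).
Proof. by move=> ok K L /negbTE nA; rewrite coefs_block// /block_coefs nA. Qed.

Lemma supportedZ A c g : supported A g -> supported A (c *: g).
Proof. by move=> gA K L nA; rewrite coefsZ gA ?mulr0. Qed.

Lemma norm_disjoint A B f g : (forall nu, ~~ (A nu && B nu)) ->
  supported A f -> supported B g -> `|f| <= 1 -> `|g| <= 1 -> `|f + g| <= 1.
Proof.
move=> AB fA gB f1 g1.
have [|nu L|fgE fg1] := @norm_strips R 1 (coefs (f + g)) ler01.
- move=> nu N N'; have [rt rs] := (fun K => proj1 (strip_root_cat nu K),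
    fun K => proj2 (strip_root_cat nu K)).
  have sq1 (h : BMO R) : `|h| <= 1 -> carleson (1 ^+ 2) N N' (fun K => coefs h (strip_root nu ++ K)).
    move=> h1; apply: (@carleson_le _ (`|h| ^+ 2)); first by rewrite lerXn2r ?nnegrE.
    by apply: carleson_root; exact: carleson_norm.
  have [Anu|nAnu] := boolP (A nu).
    have nB : ~~ B nu by move: (AB nu); rewrite Anu.
    apply: eq_carleson (sq1 f f1) => K L.
    by rewrite coefsD (gB _ L) ?addr0// rt rs.
  apply: eq_carleson (sq1 g g1) => K L.
  by rewrite coefsD (fA _ L) ?add0r// rt rs.
- by rewrite coefsD fA ?gB ?addr0// strip_nseq.
by have <- : bmo_of (coefs (f + g)) = f + g by apply: bmo_ext => K L; rewrite fgE.
Qed.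

End supports.

Definition inrange (j : nat -> nat) : pred nat := fun nu => `[< exists k, j k = nu >].

Lemma incr_inj j : incr j -> injective j.
Proof.
by move=> ij k l e; case: (ltngtP k l) => // /ij; rewrite e ltnn.
Qed.

Lemma incr_ge j k : incr j -> (k <= j k)%N.
Proof.
move=> ij; elim: k => // k IH; exact: leq_ltn_trans IH (ij _ _ (ltnSn k)).
Qed.

Section rosenthal.
Variables (R : realType) (Gam : R).

Definition functional (phi : BMO R -> R) :=
  (forall c f g, phi (c *: f + g) = c * phi f + phi g) /\
  (forall f, `|phi f| <= Gam * `|f|).

Lemma functional0 phi : functional phi -> phi 0 = 0.
Proof.
move=> [lin _]; have := lin (-1) 0 0; rewrite scaler0 addr0; lra.
Qed.

Lemma functionalZ phi c f : functional phi -> phi (c *: f) = c * phi f.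
Proof. by move=> h; rewrite -[c *: f]addr0 h.1 (functional0 h) addr0. Qed.

Lemma functionalD phi f g : functional phi -> phi (f + g) = phi f + phi g.
Proof. by move=> h; rewrite -[f]scale1r h.1 mul1r scale1r. Qed.

Lemma functional_sum phi (I : Type) (r : seq I) (P : pred I) (F : I -> BMO R) :
  functional phi -> phi (\sum_(i <- r | P i) F i) = \sum_(i <- r | P i) phi (F i).
Proof.
move=> h; apply: big_morph => [f g|]; [exact: functionalD|exact: functional0].
Qed.

(** Otherwise every subsequence of the strips would support a vector of norm at
    most 1 at which phi is at least e.  Splitting a subsequence into two again and again yields k such
    vectors in disjoint strips; their sum still has norm at most 1, whereas phi
    is at least k e there. *)
Lemma rosenthal_one phi e j : functional phi -> 0 < e -> incr j ->
  exists2 i, incr i & forall g, supported (inrange (j \o i)) g -> `|phi g| <= e * `|g|.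
Proof.
move=> h e0 ij; apply: contrapT => nex.
have bad i : incr i -> exists g, [/\ supported (inrange (j \o i)) g, `|g| <= 1 & e <= phi g].
  move=> ii; apply: contrapT => nbad; apply: nex; exists i => // g gs.
  have [//|lt_eg] := leP `|phi g| (e * `|g|); exfalso; apply: nbad.
  have [g0|g0] := eqVneq g 0.
    by move: lt_eg; rewrite g0 (functional0 h) !normr0 mulr0 ltxx.
  have ng : 0 < `|g| by rewrite normr_gt0.
  exists ((Num.sg (phi g) / `|g|) *: g); split; first exact: supportedZ.
    rewrite normrZ normrM normfV normr_id -mulrA mulVf ?gt_eqF// mulr1 normr_sg.
    by rewrite lern1; case: eqP.
  rewrite (functionalZ _ _ h) mulrAC -normrEsg ler_pdivlMr//.
  exact: ltW.
have claim k i : incr i ->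
    exists g, [/\ supported (inrange (j \o i)) g, `|g| <= 1 & k%:R * e <= phi g].
  elim: k i => [|k IH] i ii.
    exists 0; split => [K L _||]; [exact: coefs0|by rewrite normr0|].
    by rewrite (functional0 h) mul0r.
  have ie : incr (fun a => i a.*2) by move=> a b ab; apply: ii; rewrite ltn_double.
  have io : incr (fun a => i a.*2.+1) by move=> a b ab; apply: ii; rewrite ltnS ltn_double.
  have [f [fs f1 fe]] := IH _ ie; have [g [gs g1 ge]] := bad _ io.
  have sub l : (forall a, exists b, l a = i b) ->
      forall nu, inrange (j \o l) nu -> inrange (j \o i) nu.
    by move=> li nu /asboolP[a <-]; apply/asboolP; have [b /= ->] := li a; exists b.
  exists (f + g); split.
  - move=> K L nK; rewrite coefsD.
    rewrite (supportedS (sub (fun a => i a.*2) _) fs)//; last by move=> a; exists a.*2.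
    rewrite (supportedS (sub (fun a => i a.*2.+1) _) gs) ?addr0//.
    by move=> a; exists a.*2.+1.
  - apply: norm_disjoint fs gs f1 g1 => nu; apply/negP => /andP[/asboolP[a aE] /asboolP[b]].
    rewrite -aE /= => /(incr_inj ij)/(incr_inj ii)/(congr1 odd).
    by rewrite /= !odd_double.
  - by rewrite (functionalD _ _ h) -natr1 mulrDl mul1r lerD.
have id_incr : incr id by [].
pose k := (Num.truncn (Gam / e)).+1.
have [g [_ g1 kg]] := claim k id id_incr.
have Gk : Gam < k%:R * e by rewrite -ltr_pdivrMr// truncnS_gt.
have Gam0 : 0 <= Gam * `|g| by apply: le_trans (h.2 g).
have := le_trans (ler_norm _) (h.2 g) => pg.
have : Gam * `|g| <= Num.max Gam 0.
  have [G0|G0] := leP 0 Gam; first by rewrite ler_piMr.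
  by rewrite mulr_le0_ge0// ltW.
have ke0 : 0 < k%:R * e by rewrite mulr_gt0// ltr0n.
have : Num.max Gam 0 < k%:R * e by rewrite gt_max Gk.
lra.
Qed.

Lemma rosenthal (X : finType) (phi : X -> BMO R -> R) e j :
  (forall x, functional (phi x)) -> 0 < e -> incr j ->
  exists2 i, incr i & forall x g, supported (inrange (j \o i)) g -> `|phi x g| <= e * `|g|.
Proof.
move=> h e0 ij.
suff [i ii iP] : exists2 i, incr i & forall x, x \in enum X -> forall g,
    supported (inrange (j \o i)) g -> `|phi x g| <= e * `|g|.
  by exists i => // x; apply: iP; rewrite mem_enum.
elim: (enum X) => [|x s [i ii iP]]; first by exists id.
have iji : incr (j \o i) by move=> a b /ii/ij.
have [l il lP] := rosenthal_one (h x) e0 iji.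
exists (i \o l); first by move=> a b /il/ii.
move=> y; rewrite inE => /predU1P[->|ys] g gs; first exact: lP.
apply: iP => //; apply: supportedS gs => nu /asboolP[a <-]; apply/asboolP.
by exists (l a).
Qed.

End rosenthal.

Section selection.
Variables (R : realType) (S : {linear BMO R -> BMO R}) (Gam : R).
Hypotheses (Gam0 : 0 <= Gam) (SGam : forall f, `|S f| <= Gam * `|f|).

Local Notation W n := (n.-bseq bool).
Definition ncoefs n : R := \sum_(m < n.+1) #|{: W m * W m}|%:R.
(** The accuracy of the entries in strip n.  It beats the number [ncoefs n] of all
    coefficients that are copied into the strips up to n, with a factor n.+1 to spare. *)
Definition tol n : R := (n.+1%:R * ncoefs n)^-1.

Lemma ncoefs_gt0 n : 0 < ncoefs n.
Proof.
rewrite /ncoefs (bigD1 ord_max)//= ltr_wpDr ?sumr_ge0// ltr0n.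
by apply/card_gt0P; exists ([bseq], [bseq]).
Qed.

Lemma tol_gt0 n : 0 < tol n.
Proof. by rewrite invr_gt0 mulr_gt0// ?ltr0n// ncoefs_gt0. Qed.

Lemma ncoefs_tol n : ncoefs n * tol n = n.+1%:R^-1.
Proof. by rewrite /tol invfM mulrCA divff ?mulr1// gt_eqF// ncoefs_gt0. Qed.

Lemma block_pred1 (sg : nat -> block_system) n f :
  block (fun=> sg n) (pred1 n) f = block sg (pred1 n) f :> BMO R.
Proof.
rewrite /block; congr bmo_of; apply/funext => K; apply/funext => L.
by rewrite /block_coefs /=; case: eqVneq => [->|_]; rewrite ?andbF.
Qed.

(** The systems are chosen one strip after the other: the images under S of the
    block basis vectors of the earlier strips are the finitely many vectors on which
    the projection of the new strip has to be small. *)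
Lemma block_systems_exist : exists (sg : nat -> block_system) (Lam : nat -> R),
  [/\ forall n, block_system_ok (sg n), forall n, `|Lam n| <= Gam,
   (forall n I J I' J', (size I <= n)%N -> (size J <= n)%N ->
      (size I' <= n)%N -> (size J' <= n)%N ->
      `|unblock (sg n) n (S (block sg (pred1 n) (haar R I' J'))) I J -
        ((I == I') && (J == J'))%:R * Lam n| <= tol n) &
   (forall n m I J I' J', (m < n)%N -> (size I <= n)%N -> (size J <= n)%N ->
      (size I' <= m)%N -> (size J' <= m)%N ->
      `|unblock (sg n) n (S (block sg (pred1 m) (haar R I' J'))) I J| <= tol n)].
Proof.
have /choice[Lam LamP] : forall n, exists L : R, `|L| <= Gam /\
  forall (e : R) (G : seq (BMO R)), 0 < e -> exists sg, [/\ block_system_ok sg,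
    (forall g I J, g \in G -> (size I <= n)%N -> (size J <= n)%N ->
       `|unblock sg n g I J| <= e) &
    (forall I J I' J', (size I <= n)%N -> (size J <= n)%N ->
       (size I' <= n)%N -> (size J' <= n)%N ->
       `|unblock sg n (S (block (fun=> sg) (pred1 n) (haar R I' J'))) I J -
        ((I == I') && (J == J'))%:R * L| <= e)].
  by move=> n; have [L LG LP] := block_system_exists Gam0 SGam n; exists L.
pose s0 := BlockSystem (Digits 0 id (fun=> [::])) (Digits 0 id (fun=> [::])) (fun _ _ => false).
pose G (h : seq block_system) : seq (BMO R) := flatten
  [seq [seq S (block (fun=> nth s0 h m) (pred1 m) (haar R (val Q.1) (val Q.2)))
        | Q : W m * W m <- enum {: W m * W m}] | m <- iota 0 (size h)].
have /choice[nx nxP] := fun h : seq block_system =>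
  (LamP (size h)).2 (tol (size h)) (G h) (tol_gt0 _).
pose hist n := iter n (fun h => rcons h (nx h)) [::].
pose sg n := nx (hist n).
have size_hist n : size (hist n) = n.
  by elim: n => //= n IH; rewrite size_rcons IH.
have nth_hist n m : (m < n)%N -> nth s0 (hist n) m = sg m.
  elim: n => // n IH; rewrite ltnS leq_eqVlt /= nth_rcons size_hist.
  by case: ltngtP => //= [/IH|->].
have GP n m I J : (m < n)%N -> (size I <= m)%N -> (size J <= m)%N ->
    S (block sg (pred1 m) (haar R I J)) \in G (hist n).
  move=> mn Im Jm; apply/flatten_mapP; exists m.
    by rewrite mem_iota size_hist.
  apply/mapP; exists (Bseq Im, Bseq Jm); first by rewrite mem_enum.
  by rewrite /= nth_hist// (block_pred1 sg m).
exists sg, Lam; split => [n|n|n I J I' J'|n m I J I' J'].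
- by have [] := nxP (hist n).
- by have [] := LamP n.
- have [_ _] := nxP (hist n); rewrite size_hist => h In Jn In' Jn'.
  by rewrite -(block_pred1 sg n); exact: h.
- move=> mn In Jn Im Jm; have [_ h _] := nxP (hist n).
  by rewrite size_hist -/(sg n) in h; apply: h => //; exact: GP.
Qed.

Lemma functional_unblock sg n I J :
  functional Gam (fun g => unblock sg n (S g) I J).
Proof.
split=> [c f g|f]; first by rewrite linearP unblock_linear.
by apply: le_trans (unblock_le _ _ _ _ _) (SGam _).
Qed.

(** A diagonal argument: the first strip of the current subsequence is kept, and the
    rest is thinned out by [rosenthal] for the functionals that belong to that strip. *)
Lemma selection_exists (sg : nat -> block_system) : exists2 j, incr j &
  forall k I J g, (size I <= j k)%N -> (size J <= j k)%N ->
    supported (fun nu => inrange j nu && (j k < nu)%N) g ->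
    `|unblock (sg (j k)) (j k) (S g) I J| <= (j k).+1%:R^-1 * `|g|.
Proof.
have /choice[nx nxP] : forall j : nat -> nat, exists i, incr j ->
    incr i /\ forall I J g, (size I <= j 0)%N -> (size J <= j 0)%N ->
      supported (inrange (j \o succn \o i)) g ->
      `|unblock (sg (j 0)) (j 0) (S g) I J| <= (j 0).+1%:R^-1 * `|g|.
  move=> j; have [ij|nij] := pselect (incr j); last by exists id.
  have ijS : incr (j \o succn) by move=> a b ab; apply: ij; rewrite ltnS.
  have e0 : 0 < (j 0).+1%:R^-1 :> R by rewrite invr_gt0 ltr0n.
  have [i ii iP] := rosenthal (X := (W (j 0) * W (j 0))%type)
    (fun Q => functional_unblock (sg (j 0)) (j 0) Q.1 Q.2) e0 ijS.
  exists i => _; split => // I J g Ij Jj gs.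
  exact: (iP (Bseq Ij, Bseq Jj)).
pose st j := j \o succn \o nx j.
pose J k := iter k st id.
have JS k : J k.+1 = J k \o succn \o nx (J k) by [].
have iJ k : incr (J k).
  elim: k => [|k IH]; first by move=> a b.
  rewrite JS => a b ab; apply: (IH).
  by rewrite ltnS; apply: (nxP _ IH).1.
pose j k := J k 0%N.
have JJ k l a : exists b, J (l + k)%N a = J k b.
  elim: l a => [|l IH] a; first by exists a.
  by rewrite addSn JS /=; exact: IH.
have ij : incr j.
  have jS k : (j k < j k.+1)%N by rewrite /j JS /=; exact: iJ.
  by apply: (@homo_ltn _ j (fun k l => (k < l)%N)) => // k l r; exact: ltn_trans.
exists j => // k I J' g Ik Jk gs; apply: (nxP _ (iJ k)).2 => //.
apply: supportedS gs => nu /andP[/asboolP[l <-] kl]; apply/asboolP.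
have {}kl : (k < l)%N by rewrite ltnNge; apply/negP => lk; move: kl;
  rewrite ltnNge; case/negP; move: lk; rewrite leq_eqVlt => /predU1P[->//|/ij/ltnW].
have [b bE] := JJ k.+1 (l - k.+1)%N 0%N.
by exists b; rewrite /j -[in RHS](subnK kl) bE JS.
Qed.

End selection.

(** * The factorization *)

Section carleson_limit.
Variable R : realType.
Local Notation U := free_ultra.

Lemma cvg_wmean N (G : nat -> word -> R) (H : word -> R) :
  (forall x, G k x @[k --> U] --> H x) ->
  wmean N (G k) @[k --> U] --> wmean N H.
Proof.
elim: N G H => [|N IH] G H GH /=; first exact: GH.
apply: cvgMl; apply: cvgD; apply: IH => x; exact: GH.
Qed.

Lemma cvg_sum_ultra (I : Type) (r : seq I) (G : nat -> I -> R) (H : I -> R) :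
  (forall i, G k i @[k --> U] --> H i) ->
  \sum_(i <- r) G k i @[k --> U] --> \sum_(i <- r) H i.
Proof.
move=> GH; elim: r => [|i r IH].
  by rewrite big_nil; under eq_cvg do rewrite big_nil; exact: cvg_cst.
by rewrite big_cons; under eq_cvg do rewrite big_cons; exact: cvgD.
Qed.

(** The inequality for one family of rectangles involves finitely many
    coefficients, hence it passes to coefficientwise limits. *)
Lemma carleson_cvg c N N' (a : nat -> word -> word -> R) (b : word -> word -> R) :
  (forall K L, a k K L @[k --> U] --> b K L) ->
  (exists k0, forall k, (k0 <= k)%N -> carleson c N N' (a k)) -> carleson c N N' b.
Proof.
move=> ab [k0 ca] F.
have cv : wmean N (fun x => wmean N' (sqsum F (a k) N N' x)) @[k --> U] -->
    wmean N (fun x => wmean N' (sqsum F b N N' x)).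
  apply: cvg_wmean => x; apply: cvg_wmean => y; rewrite /sqsum.
  apply: cvg_sum_ultra => i; apply: cvg_sum_ultra => j.
  by apply: cvgMr; apply: cvgM; exact: ab.
apply: cvgr_to_le cv _; apply: free_ultra_eventually; exists k0 => // k kk.
exact: ca.
Qed.

End carleson_limit.

Lemma linear_map (R : realType) (V : lmodType R) (f : V -> V) : linear f ->
  exists g : {linear V -> V}, forall x, g x = f x.
Proof.
move=> flin; pose m := GRing.isLinear.Build R V V *:%R f flin.
pose g : {linear V -> V} := HB.pack f m.
by exists g.
Qed.

Lemma opnorm_le (R : realType) (V : normedModType R) (f : V -> V) (c : R) : 0 <= c ->
  (forall x, `|f x| <= c * `|x|) -> (opnorm f <= c%:E)%E.
Proof.
move=> c0 fc; apply: ge_ereal_sup => _ /= [x x1 <-]; rewrite lee_fin.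
by apply: le_trans (fc x) _; rewrite ler_piMr.
Qed.

Lemma bounded_of_le (R : realType) (V : normedModType R) (f : V -> V) (c : R) : 0 <= c ->
  (forall x, `|f x| <= c * `|x|) -> bounded_fun_norm f.
Proof.
by move=> c0 fc r; exists (c * r) => x xr; apply: le_trans (fc x) _; rewrite ler_wpM2l.
Qed.

Lemma bounded_linear (R : realType) (V : normedModType R) (f : {linear V -> V}) :
  bounded_fun_norm f -> exists2 c, 0 <= c & forall x, `|f x| <= c * `|x|.
Proof.
move=> /(_ 1)[M fM]; exists `|M| => // x.
have [->|x0] := eqVneq x 0; first by rewrite linear0 !normr0 mulr0.
have nx : 0 < `|x| by rewrite normr_gt0.
have := fM (`|x|^-1 *: x); rewrite linearZ/= !normrZ normfV normr_id mulVf ?gt_eqF//.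
move=> /(_ (lexx _)) h; rewrite -ler_pdivrMr// mulrC; apply: le_trans h _.
exact: ler_norm.
Qed.

Section factorization.
Variables (R : realType) (S : {linear BMO R -> BMO R}) (Gam : R).
Hypotheses (Gam0 : 0 <= Gam) (SGam : forall f, `|S f| <= Gam * `|f|).

(** In strip n, S E f splits into the contributions of the copies of f in the earlier
    strips, in strip n itself, and in the later ones.  After the projection the first
    and the last are at most ||f|| / (n + 1), and the middle one is as close to the
    coefficient of f times the scalar of the strip.  The scalars of the strips have a
    limit lam along the ultrafilter. *)
Lemma scalar_compression : exists (E P : {linear BMO R -> BMO R}) (lam : R),
  [/\ (forall f, `|E f| <= `|f|), (forall f, `|P f| <= `|f|),
      (forall f, P (E f) = f) & (forall f, P (S (E f)) = lam *: f)].
Proof.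
have [sg [Lam [ok LamG self_entryP backP]]] := block_systems_exist Gam0 SGam.
have [j ij fwdP] := selection_exists SGam sg.
have jk k : (k <= j k)%N := incr_ge k ij.
pose A := inrange j.
have Aj k : A (j k) by apply/asboolP; exists k.
have [E EE] := @linear_map R (BMO R) _ (block_linear ok A).
pose u (g : BMO R) I J k := unblock (sg (j k)) (j k) g I J.
have bu g I J : bounded_seq (u g I J).
  by exists `|g| => k; exact: unblock_le.
pose pc (g : BMO R) I J := ulim (u g I J).
have pcP g : coefs (bmo_of (pc g)) = pc g /\ `|bmo_of (pc g)| <= `|g|.
  apply: coefs_bmo_of => // N.
  apply: (@carleson_cvg _ _ _ _ (fun k I J => u g I J k)) => [I J|].
    exact: cvg_ulim.
  exists N => k Nk; apply: (@carleson_mono _ _ N N (j k) (j k));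
    try exact: leq_trans Nk (jk k).
  exact: carleson_unblock.
have plin : linear (fun g => bmo_of (pc g)).
  move=> c f g; apply: bmo_ext => I J.
  rewrite coefsD coefsZ !(proj1 (pcP _)) /pc -ulimZ//.
  rewrite -ulimD//; last first.
    by exists (`|c| * `|f|) => k; rewrite normrM ler_wpM2l// unblock_le.
  by congr ulim; apply/funext => k; rewrite /u unblock_linear.
have [P PE] := @linear_map R (BMO R) _ plin.
have coefsP g I J : coefs (P g) I J = ulim (u g I J) by rewrite PE (proj1 (pcP g)).
exists E, P, (ulim (fun k => Lam (j k))); split.
- by move=> f; rewrite EE; exact: norm_block.
- by move=> f; rewrite PE; have [] := pcP f.
- move=> f; apply: bmo_ext => I J; rewrite coefsP EE; apply: cvg_ulimE.
  apply: cvg_near_cst; exists (maxn (size I) (size J)) => // k /=; rewrite geq_max => /andP[Ik Jk].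
  by apply/eqP; rewrite /u (unblock_block ok)// ?(leq_trans Ik)// (leq_trans Jk).
move=> f; apply: bmo_ext => I J; rewrite coefsP coefsZ.
have bLam : bounded_seq (fun k => Lam (j k)) by exists Gam => k.
pose d k := u (S (E f)) I J k - coefs f I J * Lam (j k).
have ud : u (S (E f)) I J = fun k => d k + coefs f I J * Lam (j k).
  by apply/funext => k; rewrite /d subrK.
have bZ : bounded_seq (fun k => coefs f I J * Lam (j k)).
  by exists (`|coefs f I J| * Gam) => k; rewrite normrM ler_wpM2l.
have bd : bounded_seq d.
  have [M1 h1] := bu (S (E f)) I J; have [M2 h2] := bZ; exists (M1 + M2) => k.
  by apply: le_trans (ler_normB _ _) _; rewrite lerD// ?h1 ?h2.
rewrite ud ulimD// ulimZ// mulrC -[RHS]add0r; congr (_ + _).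
apply: cvg_ulimE.
have dle k : (maxn (size I) (size J) <= k)%N -> `|d k| <= 3 * `|f| * k.+1%:R^-1.
  rewrite geq_max => /andP[Ik Jk]; set n := j k.
  have In : (size I <= n)%N := leq_trans Ik (jk k).
  have Jn : (size J <= n)%N := leq_trans Jk (jk k).
  pose phi g := unblock (sg n) n (S g) I J.
  have phiF : functional Gam phi by exact: functional_unblock.
  pose A1 nu := A nu && (nu < n)%N; pose A2 nu := A nu && (n < nu)%N.
  have Esplit : E f = block sg A1 f + (block sg (pred1 n) f + block sg A2 f).
    rewrite EE -!blockU//.
    + congr block; apply/funext => nu; rewrite /A1 /A2 /=.
      by case: ltngtP => [_|_|->]; rewrite ?andbT ?andbF ?orbF// Aj.
    + by move=> nu; rewrite /A1 /A2 /=; case: ltngtP => //=; rewrite ?andbF.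
    + by move=> nu; rewrite /A2 /=; case: eqVneq => [->|//]; rewrite ltnn andbF.
  pose W m := m.-bseq bool.
  have backE : block sg A1 f = \sum_(m < n | A m) block sg (pred1 (m : nat)) f.
    apply: bmo_ext => K L; rewrite coefs_sum !coefs_block// /block_coefs.
    under eq_bigr do rewrite coefs_block// /block_coefs.
    case: (has negb K) => /=; last by rewrite big1.
    rewrite /A1; have [sn|sn] := ltnP (strip K) n; rewrite ?andbT ?andbF; last first.
      by rewrite big1// => m _; rewrite gtn_eqF// (leq_trans (ltn_ord m)).
    case: (boolP (A (strip K))) => [As|nAs].
      rewrite (bigD1 (Ordinal sn))//= eqxx big1 ?addr0// => m /andP[_ ms].
      by have /negbTE -> : (strip K != m :> nat) by apply: contra ms => /eqP e; apply/eqP/val_inj.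
    by rewrite big1// => m Am; case: eqVneq Am nAs => // <- ->.
  have back : `|phi (block sg A1 f)| <= `|f| / n.+1%:R.
    rewrite backE (functional_sum _ _ _ phiF).
    apply: (@le_trans _ _ (\sum_(m < n | A m) #|{: W m * W m}|%:R * (`|f| * tol R n))).
      apply: le_trans (ler_norm_sum _ _ _) _; apply: ler_sum => m _.
      rewrite block_pred1_sum// (functional_sum _ _ _ phiF).
      apply: le_trans (ler_norm_sum _ _ _) _.
      rewrite mulr_natl -sumr_const; apply: ler_sum => Q _.
      rewrite (functionalZ _ _ phiF) normrM ler_pM// ?ler_norm_coefs//.
      by apply: backP; rewrite ?size_bseq.
    rewrite -mulr_suml -ncoefs_tol [leRHS]mulrCA ler_wpM2r//.
      by rewrite mulr_ge0// ltW// tol_gt0.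
    rewrite /ncoefs big_ord_recr/= big_mkcond/=; apply: ler_wpDr => //.
    by apply: ler_sum => m _; case: ifP.
  have mid : `|phi (block sg (pred1 n) f) - coefs f I J * Lam n| <= `|f| / n.+1%:R.
    have -> : phi (block sg (pred1 n) f) - coefs f I J * Lam n =
        \sum_(Q : W n * W n) coefs f Q.1 Q.2 *
          (phi (block sg (pred1 n) (haar R Q.1 Q.2)) -
           ((I == val Q.1) && (J == val Q.2))%:R * Lam n).
      rewrite block_pred1_sum// (functional_sum _ _ _ phiF).
      under eq_bigr do rewrite (functionalZ _ _ phiF).
      under [RHS]eq_bigr do rewrite mulrBr.
      rewrite [RHS]big_split/=; congr (_ + _).
      rewrite (bigD1 (Bseq In, Bseq Jn))//= !eqxx mul1r big1 ?addr0// => -[I' J'] /= IJ.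
      case: eqVneq => [eI|_] /=; last by rewrite mul0r mulr0 oppr0.
      case: eqVneq => [eJ|_] /=; last by rewrite mul0r mulr0 oppr0.
      by case/eqP: IJ; congr pair; apply: val_inj.
    apply: le_trans (ler_norm_sum _ _ _) _.
    apply: (@le_trans _ _ (#|{: W n * W n}|%:R * (`|f| * tol R n))).
      rewrite mulr_natl -sumr_const; apply: ler_sum => Q _.
      rewrite normrM ler_pM// ?ler_norm_coefs//.
      by apply: self_entryP; rewrite ?size_bseq.
    rewrite -ncoefs_tol [leRHS]mulrCA ler_wpM2r//.
      by rewrite mulr_ge0// ltW// tol_gt0.
    by rewrite /ncoefs big_ord_recr/= lerDr sumr_ge0.
  have fwd : `|phi (block sg A2 f)| <= `|f| / n.+1%:R.
    rewrite mulrC; apply: le_trans (fwdP k I J _ In Jn (supported_block _ ok)) _.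
    by rewrite ler_wpM2l ?invr_ge0// norm_block.
  have -> : d k = phi (block sg A1 f) + ((phi (block sg (pred1 n) f) - coefs f I J * Lam n) +
      phi (block sg A2 f)).
    by rewrite /d /u -/n -/(phi _) Esplit !(functionalD _ _ phiF); ring.
  apply: le_trans (ler_normD _ _) _; apply: le_trans (lerD (lexx _) (ler_normD _ _)) _.
  have nk : `|f| / n.+1%:R <= `|f| / k.+1%:R.
    by rewrite ler_wpM2l// lef_pV2 ?posrE ?ltr0n// ler_nat ltnS.
  apply: le_trans (lerD back (lerD mid fwd)) _.
  have -> : 3 * `|f| / k.+1%:R = `|f| / k.+1%:R + (`|f| / k.+1%:R + `|f| / k.+1%:R) by ring.
  by rewrite !lerD.
apply/cvgr0Pnorm_le => e e0.
have [K _ KP] : \forall k \near \oo, 3 * `|f| * (k.+1%:R^-1 : R) <= e.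
  have h : 3 * `|f| * (k.+1%:R^-1 : R) @[k --> \oo] --> 3 * `|f| * 0.
    by apply: cvgMr; exact: cvg_harmonic.
  by rewrite mulr0 in h; move/cvgr_le: h; apply.
exists (maxn K (maxn (size I) (size J))) => // k /=; rewrite geq_max => /andP[Kk sk].
exact: le_trans (dle k sk) (KP k Kk).
Qed.

End factorization.

Theorem theorem1p1 (R : realType) :
  exists2 C : R, 0 < C &
    forall S : {linear BMO R -> BMO R}, bounded_fun_norm S ->
    exists2 H : BMO R -> BMO R,
      H = (fun f => S f) \/ H = (fun f => f - S f) &
      exists E P : {linear BMO R -> BMO R},
        [/\ bounded_fun_norm E, bounded_fun_norm P,
            (forall f : BMO R, P (H (E f)) = f) &
            (opnorm E * opnorm P <= C%:E)%E].
Proof.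
exists 2 => // S /bounded_linear[Gam Gam0 SGam].
have [E [P [lam [E1 P1 PE PSE]]]] := scalar_compression Gam0 SGam.
have concl (H : BMO R -> BMO R) (mu : R) : 1 / 2 <= `|mu| ->
    (forall f, P (H (E f)) = mu *: f) ->
    exists E P : {linear BMO R -> BMO R},
        [/\ bounded_fun_norm E, bounded_fun_norm P,
            (forall f : BMO R, P (H (E f)) = f) &
            (opnorm E * opnorm P <= 2%:E)%E].
  move=> mu2 PH; have mu0 : mu != 0 by rewrite -normr_gt0; lra.
  have Qlin : linear (fun f => mu^-1 *: P f).
    by move=> c f g; rewrite linearP scalerDr !scalerA mulrC.
  have [Q QE] := @linear_map R (BMO R) _ Qlin.
  have EE f : `|E f| <= 1 * `|f| by rewrite mul1r.
  have QQ f : `|Q f| <= 2 * `|f|.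
    rewrite QE normrZ ler_pM// normfV -[leRHS]invrK lef_pV2 ?posrE ?invr_gt0 ?normr_gt0//.
    by rewrite -[2^-1]mul1r.
  exists E, Q; split.
  - exact: bounded_of_le EE.
  - exact: bounded_of_le QQ.
  - by move=> f; rewrite QE PH scalerA mulVf// scale1r.
  have e1 := opnorm_le ler01 EE; have q2 := opnorm_le (ler0n R 2) QQ.
  have q0 : (0 <= opnorm Q)%E.
    apply: ereal_sup_ubound; exists 0; rewrite /= ?linear0 ?normr0//.
  by rewrite -[leRHS]mul1e lee_pmul//; apply: ereal_sup_ubound; exists 0; rewrite /= ?linear0 ?normr0.
have [lam2|lam2] := leP (1 / 2) `|lam|.
  exists (fun f => S f); first by left.
  exact: concl lam2 PSE.
exists (fun f => f - S f); first by right.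
apply: (concl (fun f => f - S f) (1 - lam)) => [|f]; last by rewrite linearB PE PSE scalerBl scale1r.
have := ler_normD lam (1 - lam); rewrite [lam + _](_ : _ = 1); last by ring.
by rewrite normr1; lra.
Qed.
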